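(* Let $k\ge 2$, let $p\in\mathbb{C}^k$, let $0<s<r<1$ be such that $r^2<s$, let $\delta>0$, and let $\{F_j\}_{j\ge 1}\subset \mathrm{Aut}_p(\mathbb{C}^k)$ be a sequence such that $$s\|z-p\|\leq\|F_j(z)-p\|\leq r\|z-p\|\quad\text{for all } z\in B_\delta(p)\text{ and all } j\ge 1.$$ Then there exists a biholomorphic map $$\Phi\colon\Omega^p_{\{F_j\}}\rightarrow\Phi(\Omega^p_{\{F_j\}})=\mathbb{C}^k.$$
   Context: $B_\delta(p)$ is the open ball in $\mathbb{C}^k$ with center $p$ and radius $\delta$. $\mathrm{Aut}_p(\mathbb{C}^k)$ is the group of holomorphic automorphisms of $\mathbb{C}^k$ fixing the point $p$. For a sequence $\{F_j\}_{j\ge1}\subset \mathrm{Aut}_p(\mathbb{C}^k)$ write $F(j)=F_j\circ\cdots\circ F_1$; the basin of attraction of $p$ is $$\Omega^p_{\{F_j\}}=\{z\in\mathbb{C}^k:\ \lim_{j\to\infty}F(j)(z)=p\}.$$ *)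

(* Defs.v *)
From HB Require Import structures.
From mathcomp Require Import all_boot all_order all_algebra.
From mathcomp Require Import all_classical all_reals all_analysis.
From mathcomp Require Import complex.

Set Implicit Arguments.
Unset Strict Implicit.
Unset Printing Implicit Defensive.

Import Order.TTheory GRing.Theory Num.Theory.
Import numFieldNormedType.Exports.

Local Open Scope classical_set_scope.
Local Open Scope complex_scope.
Local Open Scope ring_scope.

(* R[i] as a bundled structure: the topology and the norm on numeric fields are
   attached to elements of numClosedFieldType, not to the bare type R[i]. *)
Definition Cplx (R : realType) : numClosedFieldType := R[i].

(* The library norm on 'rV[Cplx R]_k is the sup norm with values in Cplx R; it
   induces the same topology, and the same differentiable maps, as this
   Euclidean one. *)
Definition enorm (R : realType) (k : nat) (z : 'rV[Cplx R]_k) : R :=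
  Num.sqrt (\sum_(i < k) Normc.normc (z ord0 i) ^+ 2).

Definition eball (R : realType) (k : nat) (p : 'rV[Cplx R]_k) (delta : R) :
    set 'rV[Cplx R]_k :=
  [set z | enorm (z - p) < delta].

(* The scalar field of 'rV[Cplx R]_k is Cplx R, so differentiable is complex
   Frechet differentiability. Functions are total: since U is open, only the
   values of f on U matter. *)
Definition holomorphic_on (R : realType) (k : nat) (U : set 'rV[Cplx R]_k)
    (f : 'rV[Cplx R]_k -> 'rV[Cplx R]_k) : Prop :=
  open U /\ forall z, U z -> differentiable f z.

Definition biholomorphic (R : realType) (k : nat) (U V : set 'rV[Cplx R]_k)
    (f : 'rV[Cplx R]_k -> 'rV[Cplx R]_k) : Prop :=
  [/\ holomorphic_on U f,
      set_bij U V f &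
      exists g : 'rV[Cplx R]_k -> 'rV[Cplx R]_k,
        holomorphic_on V g /\ forall z, U z -> g (f z) = z].

Definition Aut_at (R : realType) (k : nat) (p : 'rV[Cplx R]_k) :
    set ('rV[Cplx R]_k -> 'rV[Cplx R]_k) :=
  [set f | biholomorphic setT setT f /\ f p = p].

(* comp_upto F j = F j \o ... \o F 1; the term F 0 is never used. *)
Fixpoint comp_upto (T : Type) (F : nat -> T -> T) (j : nat) : T -> T :=
  if j is j'.+1 then F j'.+1 \o comp_upto F j' else id.

Definition basin (R : realType) (k : nat) (p : 'rV[Cplx R]_k)
    (F : nat -> 'rV[Cplx R]_k -> 'rV[Cplx R]_k) : set 'rV[Cplx R]_k :=
  [set z | comp_upto F j z @[j --> \oo] --> p].

(* Main.v *)
Require Import Defs.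
From HB Require Import structures.
From mathcomp Require Import all_boot all_order all_algebra.
From mathcomp Require Import all_classical all_reals all_analysis.
From mathcomp Require Import complex.
From mathcomp Require Import ring lra.

(** Put p = 0 and let A_j be the derivative of F_j at 0. The candidate for Phi
is the limit of the rescaled iterates A(j)^-1 o F(j), where A(j) and F(j) are
the composites of the first j maps.

Each F_j is bounded by r delta on the ball of radius delta, so Cauchy's
estimates bound F_j(z) - A_j z by K |z|^2 with K independent of j
([contracting_second_order]). Two successive rescaled iterates therefore differ
by at most s^-(j+1) K (r^j |z|)^2, a geometric sequence of ratio r^2 / s < 1
([rescaled_step]). Hence they converge near 0, and since all of them are
O(|z|^2)-close to the identity, Cauchy's estimates again make them 1/2-Lipschitz
perturbations of the identity on a ball whose radius depends on k, s, r and
delta only ([local_conjugacy]). The limit Psi is holomorphic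
([holo_limit]); being a 1/2-Lipschitz perturbation of the identity it is
injective, its image contains a ball by Banach's fixed point theorem
([banach_perturbation]), and its inverse is holomorphic
([perturbation_inverse_diff]).

The passage to the whole basin is the functional equation
Phi = A(n)^-1 o Psi_n o F(n), where Psi_n is the local limit for the tail of the
sequence after n steps ([basin_at_origin]). An orbit of the basin enters the
common ball at some time n, so Phi is defined, holomorphic and injective on the
basin because each Psi_n is; it is onto because A(n) contracts any given vector
into the half ball covered by Psi_n.

Complex differentiability is a pointwise hypothesis, so the Cauchy estimates are
derived from Goursat's theorem ([goursat]). The form that is needed is the bound
|f'(0)| <= 6 M / rho for |f| <= M on the disc of radius rho ([cauchy_estimate]);
applied to f and to differences f(z + h) - f(z), it gives the Lipschitz and
second order estimates ([bounded_lipschitz], [bounded_taylor]), and these pass to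
several variables along complex lines. *)

Set Implicit Arguments.
Unset Strict Implicit.
Unset Printing Implicit Defensive.

Import Order.TTheory GRing.Theory Num.Theory.
Import numFieldNormedType.Exports.

Local Open Scope classical_set_scope.
Local Open Scope complex_scope.
Local Open Scope ring_scope.

Local Notation cn := (@Normc.normc _).
Local Notation re := (@complex.Re _).
Local Notation im := (@complex.Im _).

(** * The modulus of complex numbers *)

(** The imaginary unit with [Cplx R] as its type: products in which ['i : R[i]]
occurs would otherwise be taken in another, merely convertible, structure. *)
Definition ci {R : realType} : Cplx R := 'i.

Lemma complex_addi (R : realType) (x y : R) : (x +i* y : Cplx R) = x%:C + ci * y%:C.
Proof. exact: complexE. Qed.

Section ComplexNorm.
Variable R : realType.
Notation C := (Cplx R).
Implicit Types (z w : C) (x y : R).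

Lemma cn_ge0 z : 0 <= cn z.
Proof. by case: z => a b /=; rewrite sqrtr_ge0. Qed.

Lemma cnD z w : cn (z + w) <= cn z + cn w.
Proof. by have := ler_normD z w; rewrite -lecR rmorphD. Qed.

Lemma cnM z w : cn (z * w) = cn z * cn w.
Proof. exact: Normc.normcM. Qed.

Lemma cnN z : cn (- z) = cn z.
Proof. by case: z => a b /=; rewrite !sqrrN. Qed.

Lemma cnV z : cn (z^-1) = (cn z)^-1.
Proof. exact: Normc.normcV. Qed.

Lemma cn0 : cn (0 : C) = 0. Proof. exact: Normc.normc0. Qed.
Lemma cn1 : cn (1 : C) = 1. Proof. exact: Normc.normc1. Qed.

Lemma sqr_ci : ci * ci = -1 :> C.
Proof. by rewrite -expr2; exact: sqr_i. Qed.

Lemma cn_ci : cn (ci : C) = 1. Proof. by rewrite /= expr0n add0r expr1n sqrtr1. Qed.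

Lemma cn_eq0 z : cn z = 0 -> z = 0. Proof. exact: Normc.eq0_normc. Qed.

Lemma cn_gt0 z : z != 0 -> 0 < cn z.
Proof.
by move=> z0; rewrite lt_neqAle cn_ge0 andbT eq_sym; apply: contra z0 => /eqP/cn_eq0 ->.
Qed.

Lemma cn_real x : cn (x%:C) = `|x|.
Proof. by rewrite /= expr0n addr0 sqrtr_sqr. Qed.

Lemma cnB z w : cn (z - w) <= cn z + cn w.
Proof. by rewrite -(cnN w) cnD. Qed.

Lemma sqr_cn z : cn z ^+ 2 = re z ^+ 2 + im z ^+ 2.
Proof. by case: z => a b /=; rewrite sqr_sqrtr // addr_ge0 ?sqr_ge0. Qed.

Lemma Re_le_cn z : `|re z| <= cn z.
Proof.
rewrite -(@ler_pXn2r _ 2) ?nnegrE ?cn_ge0//.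
by rewrite sqr_cn real_normK ?num_real// lerDl sqr_ge0.
Qed.

Lemma Im_le_cn z : `|im z| <= cn z.
Proof.
rewrite -(@ler_pXn2r _ 2) ?nnegrE ?cn_ge0//.
by rewrite sqr_cn real_normK ?num_real// lerDr sqr_ge0.
Qed.

Lemma cn_le_ReIm z : cn z <= `|re z| + `|im z|.
Proof.
rewrite -(@ler_pXn2r _ 2) ?nnegrE ?cn_ge0 ?addr_ge0//.
rewrite sqr_cn sqrrD !real_normK ?num_real// addrAC lerDl.
by rewrite mulrn_wge0// mulr_ge0.
Qed.

Lemma reD z w : re (z + w) = re z + re w. Proof. by case: z w => [? ?] []. Qed.
Lemma imD z w : im (z + w) = im z + im w. Proof. by case: z w => [? ?] []. Qed.
Lemma reN z : re (- z) = - re z. Proof. by case: z. Qed.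
Lemma imN z : im (- z) = - im z. Proof. by case: z. Qed.
Lemma reM z w : re (z * w) = re z * re w - im z * im w.
Proof. by case: z w => [? ?] []. Qed.
Lemma imM z w : im (z * w) = re z * im w + im z * re w.
Proof. by case: z w => [? ?] []. Qed.
End ComplexNorm.

(** * Primitives of continuous functions *)

Section RealPrimitives.
Variable R : realType.
Implicit Types (a b c d x y : R).

(** Continuity up to the end points makes [P b - P a] the integral of [phi]. *)
Definition rprim (phi P : R -> R) a b :=
  {within `[a, b], continuous P} /\
  forall x, a < x < b -> is_derive x 1 P (phi x).

Lemma rprim_sub phi P a b c d : a <= c -> d <= b -> rprim phi P a b -> rprim phi P c d.
Proof.
move=> ac db [cP dP]; split; last first.
  by move=> x /andP[cx xd]; apply: dP; rewrite (le_lt_trans ac cx) (lt_le_trans xd db).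
apply: continuous_subspaceW cP => x /=; rewrite !in_itv/= => /andP[cx xd].
by rewrite (le_trans ac cx) (le_trans xd db).
Qed.

Lemma within_continuous_eps (f : R -> R) a b :
  (forall x, a <= x <= b -> forall e, 0 < e -> exists2 d, 0 < d &
     forall y, a <= y <= b -> `|y - x| < d -> `|f y - f x| <= e) ->
  {within `[a, b], continuous f}.
Proof.
move=> H; apply/subspace_continuousP => x /=; rewrite in_itv/= => xab.
apply/cvgrPdist_le => e e0; have [d d0 Hd] := H x xab e e0.
apply/nbhs_normP; exists d => //= y /= yx; rewrite in_itv/= => yab.
by rewrite distrC; apply: Hd => //; rewrite distrC.
Qed.

Lemma rprim_ex (f : R -> R) a b : {within `[a, b], continuous f} ->
  exists P, rprim f P a b.
Proof.
move=> cf; have [ab|ba] := ltP a b; last first.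
  exists (cst 0); split; first by move=> ?; exact: cst_continuous.
  by move=> x /andP[ax xb]; have := lt_trans ax (lt_le_trans xb ba); rewrite ltxx.
have If : lebesgue_measure.-integrable `[a, b] (EFin \o f).
  by apply: continuous_compact_integrable => //; exact: segment_compact.
exists (fun x => \int[lebesgue_measure]_(t in `[a, x]) f t); split.
  exact: (parameterized_integral_continuous (ltW ab) If).
move=> x /andP[ax xb].
have cx : {for x, continuous f}.
  move: cf; rewrite continuous_within_itvP// => -[+ _ _]; apply.
  by rewrite in_itv/= ax xb.
have := continuous_FTC1_closed xb If ax cx.
move: (fun _ => _) => P /= [d1 d2].
by apply: DeriveDef => //; rewrite -derive1E.
Qed.

(** Monotonicity of the integral against an affine majorant, whose integral the
midpoint rule gives exactly: the difference of the two primitives increases. *)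
Lemma rprim_le_affine phi P a b al be : a <= b -> rprim phi P a b ->
  (forall x, a <= x <= b -> phi x <= al + be * x) ->
  P b - P a <= (b - a) * (al + be * ((a + b) / 2)).
Proof.
move=> ab [cP dP] H.
pose df x := al + be * x - phi x.
pose G := (fun x : R => al * x + be / 2 * (x * x)) - P.
have dG x : x \in `]a, b[ -> is_derive x 1 G (df x).
  rewrite in_itv/= => xab; have dPx := dP _ xab.
  apply: is_derive_eq; rewrite /df /GRing.scale/=; lra.
have cG : {within `[a, b], continuous G}.
  apply: within_continuousB => //; apply: continuous_subspaceT => x.
  apply: continuousD; first by apply: continuousM => //; exact: cst_continuous.
  apply: continuousM; first exact: cst_continuous.
  by apply: continuousM.
have [c cab E] := MVT_segment ab dG cG.
have : 0 <= G b - G a.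
  rewrite E mulr_ge0 ?subr_ge0//; move: cab; rewrite in_itv/= => cab.
  exact: H.
by rewrite /G !fctE; nra.
Qed.

Lemma rprim_unique phi P Q a b : a <= b -> rprim phi P a b -> rprim phi Q a b ->
  P b - P a = Q b - Q a.
Proof.
move=> ab [cP dP] [cQ dQ].
have dG x : x \in `]a, b[ -> is_derive x 1 (P - Q) ((fun=> 0) x).
  rewrite in_itv/= => xab; have dPx := dP _ xab; have dQx := dQ _ xab.
  by apply: is_derive_eq; rewrite subrr.
have cG : {within `[a, b], continuous (P - Q)}.
  exact: within_continuousB.
have [c cab] := MVT_segment ab dG cG; rewrite mul0r !fctE; lra.
Qed.

End RealPrimitives.

(** * Complex derivatives and complex primitives *)

Section ComplexDerivative.
Variable R : realType.
Notation C := (Cplx R).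
Implicit Types (f g : C -> C) (z w l : C) (a b x y e : R).

(** The modulus is real-valued here, so that estimates are linear arithmetic
in [R]. *)
Definition cder f z l := forall e, 0 < e -> exists2 d, 0 < d &
  forall w, cn (w - z) < d -> cn (f w - f z - l * (w - z)) <= e * cn (w - z).

Lemma cder_continuous f z l : cder f z l -> forall e, 0 < e -> exists2 d, 0 < d &
  forall w, cn (w - z) < d -> cn (f w - f z) <= e.
Proof.
move=> df e e0; have [d d0 Hd] := df 1 ltr01.
have l0 := cn_ge0 l; have K0 : 0 < 1 + cn l by lra.
exists (Num.min d (e / (1 + cn l))); first by rewrite lt_min d0 divr_gt0.
move=> w; rewrite lt_min ltr_pdivlMr// mulrDr mulr1 (mulrC _ (cn l)) => /andP[/Hd h1 we].
have -> : f w - f z = (f w - f z - l * (w - z)) + l * (w - z) by ring.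
move: (cnD (f w - f z - l * (w - z)) (l * (w - z))); rewrite cnM.
lra.
Qed.

Definition cprim (phi P : R -> C) a b :=
  rprim (fun t => re (phi t)) (fun t => re (P t)) a b /\
  rprim (fun t => im (phi t)) (fun t => im (P t)) a b.

Lemma cprim_sub phi P a b c d : a <= c -> d <= b -> cprim phi P a b -> cprim phi P c d.
Proof. by move=> ac db [H1 H2]; split; apply: (rprim_sub ac db). Qed.

Lemma cprim_ex phi a b :
  (forall x, a <= x <= b -> forall e, 0 < e -> exists2 d, 0 < d &
     forall y, a <= y <= b -> `|y - x| < d -> cn (phi y - phi x) <= e) ->
  exists P, cprim phi P a b.
Proof.
move=> H.
have [|P HP] := @rprim_ex R (fun t => re (phi t)) a b.
  apply: within_continuous_eps => x xab e e0; have [d d0 Hd] := H x xab e e0.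
  exists d => // y yab yx; apply: le_trans (Hd _ yab yx).
  by rewrite -reN -reD Re_le_cn.
have [|Q HQ] := @rprim_ex R (fun t => im (phi t)) a b.
  apply: within_continuous_eps => x xab e e0; have [d d0 Hd] := H x xab e e0.
  exists d => // y yab yx; apply: le_trans (Hd _ yab yx).
  by rewrite -imN -imD Im_le_cn.
by exists (fun t => P t +i* Q t).
Qed.

Lemma rprimN (phi P : R -> R) a b : rprim phi P a b ->
  rprim (fun x => - phi x) (fun x => - P x) a b.
Proof.
move=> [cP dP]; split; last by move=> x /dP dPx; exact: is_deriveN.
by move=> x; apply: cvgN; exact: cP.
Qed.

Lemma rprim_near_affine (phi P : R -> R) a b al be e : a <= b -> rprim phi P a b ->
  (forall x, a <= x <= b -> `|phi x - (al + be * x)| <= e) ->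
  `|P b - P a - (b - a) * (al + be * ((a + b) / 2))| <= e * (b - a).
Proof.
move=> ab HP H.
have H1 := @rprim_le_affine _ _ _ _ _ (al + e) be ab HP.
have H2 := @rprim_le_affine _ _ _ _ _ (- al + e) (- be) ab (rprimN HP).
have {}H1 := H1 _.
have : P b - P a <= (b - a) * (al + e + be * ((a + b) / 2)).
  by apply: H1 => x /H; rewrite ler_norml => /andP[_]; lra.
have : - P b - - P a <= (b - a) * (- al + e + - be * ((a + b) / 2)).
  by apply: H2 => x /H; rewrite ler_norml => /andP[+ _]; lra.
rewrite ler_norml; nra.
Qed.

(** The factor 2 comes from estimating real and imaginary parts separately. *)
Lemma cprim_near_affine (phi P : R -> C) a b (al be : C) e : a <= b -> cprim phi P a b ->
  (forall x, a <= x <= b -> cn (phi x - (al + be * x%:C)) <= e) ->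
  cn (P b - P a - (b - a)%:C * (al + be * ((a + b) / 2)%:C)) <= 2 * e * (b - a).
Proof.
move=> ab [HP HQ] H.
have H1 : `|re (P b) - re (P a) - (b - a) * (re al + re be * ((a + b) / 2))| <= e * (b - a).
  apply: (rprim_near_affine ab HP) => x xab; apply: le_trans (H x xab).
  apply: le_trans (Re_le_cn _).
  by rewrite !(reD, reN, reM)/= mulr0 subr0.
have H2 : `|im (P b) - im (P a) - (b - a) * (im al + im be * ((a + b) / 2))| <= e * (b - a).
  apply: (rprim_near_affine ab HQ) => x xab; apply: le_trans (H x xab).
  apply: le_trans (Im_le_cn _).
  by rewrite !(imD, imN, imM)/= mulr0 add0r.
have -> : 2 * e * (b - a) = e * (b - a) + e * (b - a) by ring.
apply: le_trans (cn_le_ReIm _) (lerD _ _).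
  move: H1; rewrite !(reD, reN, reM, imD, imM)/=.  by rewrite !mulr0 mul0r !subr0.
move: H2; rewrite !(reD, reN, reM, imD, imM, imN)/=. by rewrite !mulr0 mul0r !addr0 add0r.
Qed.

Lemma cprim_unique phi P Q a b : a <= b -> cprim phi P a b -> cprim phi Q a b ->
  P b - P a = Q b - Q a.
Proof.
move=> ab [H1 H2] [K1 K2].
have := rprim_unique ab H1 K1; have := rprim_unique ab H2 K2.
case: (P b) (P a) (Q b) (Q a) => [? ?] [? ?] [? ?] [? ?] /= e1 e2.
by apply/eqP; rewrite eq_complex/= e1 e2 !eqxx.
Qed.

Lemma cprim_muli phi P a b : cprim phi P a b ->
  cprim (fun t => ci * phi t) (fun t => ci * P t) a b.
Proof.
move=> [H1 H2].
have E1 (psi : R -> C) : (fun t => re (ci * psi t)) = (fun t => - im (psi t)).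
  by apply/funext => t; rewrite reM /= mul0r mul1r sub0r.
have E2 (psi : R -> C) : (fun t => im (ci * psi t)) = (fun t => re (psi t)).
  by apply/funext => t; rewrite imM /= mul0r mul1r add0r.
by split; rewrite !(E1, E2)//; exact: rprimN.
Qed.

End ComplexDerivative.

(** * Goursat's theorem on rectangles *)

Section Bisection.
Variable R : realType.
Implicit Types (a b c d x y e : R).

Lemma nested_intervals (a W : nat -> R) :
  (forall n, a n <= a n.+1) -> (forall n, a n.+1 + W n.+1 <= a n + W n) ->
  (forall n, 0 <= W n) -> exists x, forall n, a n <= x <= a n + W n.
Proof.
move=> aS bS W0.
have amono m n : (m <= n)%N -> a m <= a n.
  by move=> /subnK <-; elim: (n - m)%N => //= k IH; apply: le_trans IH (aS _).
have bmono m n : (m <= n)%N -> a n + W n <= a m + W m.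
  by move=> /subnK <-; elim: (n - m)%N => //= k IH; apply: le_trans (bS _) IH.
have ub n m : a m <= a n + W n.
  have [mn|nm] := leqP m n; first by rewrite (le_trans (amono _ _ mn))// lerDl.
  by rewrite (le_trans _ (bmono _ _ (ltnW nm)))// lerDl.
have hs : has_sup (range a).
  split; first by exists (a 0%N); exists 0%N.
  by exists (a 0%N + W 0%N) => _ [m _ <-]; exact: ub.
exists (sup (range a)) => n; apply/andP; split.
  by apply: sup_upper_bound => //; exists n.
by apply: ge_sup; [exact: hs.1|move=> _ [m _ <-]; exact: ub].
Qed.

(** Cut the rectangle in four and keep a quarter that carries at least a fourth
of the value. The quarters shrink to a point, where the value is o of the square
of the perimeter; both sides decay like 4^-n, so the total is arbitrarily small. *)
Lemma bisection (mu : R -> R -> R -> R -> Cplx R) x0 x1 y0 y1 : x0 <= x1 -> y0 <= y1 ->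
  (forall m a b c d, mu a b c d = mu a m c d + mu m b c d) ->
  (forall m a b c d, mu a b c d = mu a b c m + mu a b m d) ->
  (forall x y, x0 <= x <= x1 -> y0 <= y <= y1 -> forall e, 0 < e -> exists2 r, 0 < r &
     forall a b c d, x0 <= a <= x -> x <= b <= x1 -> y0 <= c <= y -> y <= d <= y1 ->
       (b - a) + (d - c) < r -> cn (mu a b c d) <= e * ((b - a) + (d - c)) ^+ 2) ->
  mu x0 x1 y0 y1 = 0.
Proof.
move=> x01 y01 muX muY loc.
pose W n := (x1 - x0) / 2 ^+ n; pose K n := (y1 - y0) / 2 ^+ n.
have half n (u : R) : u / 2 ^+ n = 2 * (u / 2 ^+ n.+1).
  by rewrite exprS; field; rewrite expf_neq0// pnatr_eq0.
have W0 n : 0 <= W n by rewrite divr_ge0 ?subr_ge0// exprn_ge0.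
have K0 n : 0 <= K n by rewrite divr_ge0 ?subr_ge0// exprn_ge0.
have WS n : W n = 2 * W n.+1 by exact: half.
have KS n : K n = 2 * K n.+1 by exact: half.
(* q = (n, corner): one of the four quarters, of sides W n.+1 and K n.+1. *)
have step (q : nat * (R * R)) : exists p : R * R,
    [/\ q.2.1 <= p.1, p.1 + W q.1.+1 <= q.2.1 + W q.1,
        q.2.2 <= p.2, p.2 + K q.1.+1 <= q.2.2 + K q.1 &
        cn (mu q.2.1 (q.2.1 + W q.1) q.2.2 (q.2.2 + K q.1)) <=
        4 * cn (mu p.1 (p.1 + W q.1.+1) p.2 (p.2 + K q.1.+1))].
  case: q => n [a c] /=; move: (WS n) (KS n) (W0 n.+1) (K0 n.+1).
  move: (W n.+1) (K n.+1) => w k -> -> w0 k0.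
  have Ea : a + 2 * w = a + w + w by ring.
  have Ec : c + 2 * k = c + k + k by ring.
  rewrite (muX (a + w)) (muY (c + k) a) (muY (c + k) (a + w)) Ea Ec.
  set m1 := mu a _ c _; set m2 := mu a _ (c + k) _.
  set m3 := mu (a + w) _ c _; set m4 := mu (a + w) _ (c + k) _.
  have := cnD (m1 + m2) (m3 + m4); have := cnD m1 m2; have := cnD m3 m4.
  set S := cn (m1 + m2 + _) => h1 h2 h3.
  have [c1|c1] := leP S (4 * cn m1); first by exists (a, c); split=> //=; lra.
  have [c2|c2] := leP S (4 * cn m2); first by exists (a, c + k); split=> //=; lra.
  have [c3|c3] := leP S (4 * cn m3); first by exists (a + w, c); split=> //=; lra.
  have [c4|c4] := leP S (4 * cn m4); first by exists (a + w, c + k); split=> //=; lra.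
  exfalso; lra.
have [f Hf] := choice step.
pose s := fix s n : R * R := if n is m.+1 then f (m, s m) else (x0, y0).
have hs n := Hf (n, s n).
have [x Hx] : exists x, forall n, (s n).1 <= x <= (s n).1 + W n.
  by apply: nested_intervals => // n; have [] := hs n.
have [y Hy] : exists y, forall n, (s n).2 <= y <= (s n).2 + K n.
  by apply: nested_intervals => // n; have [] := hs n.
have Hin n : [/\ x0 <= (s n).1, (s n).1 + W n <= x1, y0 <= (s n).2 & (s n).2 + K n <= y1].
  elim: n => [|n [h1 h2 h3 h4]]; first by split=> //=; rewrite /W /K; lra.
  have [/= g1 g2 g3 g4 _] := hs n; split; [exact: le_trans g1|exact: le_trans h2|
    exact: le_trans g3|exact: le_trans h4].
have Hmu n : cn (mu x0 x1 y0 y1) <=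
    4 ^+ n * cn (mu (s n).1 ((s n).1 + W n) (s n).2 ((s n).2 + K n)).
  elim: n => [|n IH].
    rewrite expr0 mul1r /= /W /K expr0 !divr1.
    by rewrite (_ : x0 + (x1 - x0) = x1) 1?(_ : y0 + (y1 - y0) = y1)//; ring.
  apply: le_trans IH _; rewrite exprSr -mulrA ler_pM2l ?exprn_gt0//.
  by have [_ _ _ _] := hs n.
apply/cn_eq0/eqP; rewrite eq_le cn_ge0 andbT; apply/ler_addgt0Pl => e e0; rewrite addr0.
set D := (x1 - x0) + (y1 - y0).
have D0 : 0 <= D by rewrite /D; lra.
have xin : x0 <= x <= x1 by have := Hx 0%N; rewrite /= /W expr0; lra.
have yin : y0 <= y <= y1 by have := Hy 0%N; rewrite /= /K expr0; lra.
have e'0 : 0 < e / (1 + D ^+ 2) by rewrite divr_gt0// ltr_wpDr ?sqr_ge0.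
have [r r0 Hr] := loc x y xin yin _ e'0.
pose n := Num.bound (D / r).
have Dn : D / 2 ^+ n < r.
  rewrite ltr_pdivrMr ?exprn_gt0// mulrC -ltr_pdivrMr//.
  exact: upper_nthrootP.
have DnE : (s n).1 + W n - (s n).1 + ((s n).2 + K n - (s n).2) = D / 2 ^+ n.
  by rewrite /W /K /D; ring.
have [h1 h2 h3 h4] := Hin n.
have /andP[h5 h6] := Hx n; have /andP[h7 h8] := Hy n.
have := Hr (s n).1 ((s n).1 + W n) (s n).2 ((s n).2 + K n).
rewrite DnE h1 h2 h3 h4 h5 h6 h7 h8 => /(_ isT isT isT isT Dn) Hb.
apply: le_trans (Hmu n) _.
apply: (@le_trans _ _ (4 ^+ n * (e / (1 + D ^+ 2) * (D / 2 ^+ n) ^+ 2))).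
  by rewrite ler_pM2l// exprn_gt0.
have E4 : (4 : R) ^+ n = 2 ^+ n * 2 ^+ n by rewrite -exprMn; congr (_ ^+ _); ring.
have p2 : (2 : R) ^+ n != 0 by rewrite expf_neq0// pnatr_eq0.
have p3 : 1 + D ^+ 2 != 0 by rewrite gt_eqF// ltr_wpDr ?sqr_ge0.
rewrite [leLHS](_ : _ = e * (D ^+ 2 / (1 + D ^+ 2))); last by rewrite E4; field; rewrite p2 p3.
rewrite ger_pMr// ler_pdivrMr ?ltr_wpDr ?sqr_ge0//; lra.
Qed.

End Bisection.

Section Goursat.
Variable R : realType.
Notation C := (Cplx R).
Implicit Types (f g : C -> C) (z w l : C) (a b x y e : R).

(** [H y] and [V x] are primitives of [g] along horizontals and verticals, so that
the left-hand side is the integral of [g] along the boundary. It is additive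
under cutting, and it vanishes on affine functions; near a point, [g] is affine
up to o of the diameter, hence the boundary integral is o of its square. *)
Lemma goursat g x0 x1 y0 y1 (H V : R -> R -> C) : x0 <= x1 -> y0 <= y1 ->
  (forall x y, x0 <= x <= x1 -> y0 <= y <= y1 -> exists l, cder g (x +i* y) l) ->
  (forall y, y0 <= y <= y1 -> cprim (fun t => g (t +i* y)) (H y) x0 x1) ->
  (forall x, x0 <= x <= x1 -> cprim (fun t => g (x +i* t)) (V x) y0 y1) ->
  (H y0 x1 - H y0 x0) + ci * (V x1 y1 - V x1 y0)
  - (H y1 x1 - H y1 x0) - ci * (V x0 y1 - V x0 y0) = 0.
Proof.
move=> x01 y01 dg HH HV.
pose mu a b c d := (H c b - H c a) + ci * (V b d - V b c)
  - (H d b - H d a) - ci * (V a d - V a c).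
apply: (@bisection R mu x0 x1 y0 y1) => //.
- by move=> m a b c d; rewrite /mu; ring.
- by move=> m a b c d; rewrite /mu; ring.
move=> x y xin yin e e0; have [l Dl] := dg x y xin yin.
have [r r0 Hr] : exists2 d, 0 < d & forall w, cn (w - (x +i* y : C)) < d ->
    cn (g w - g (x +i* y) - l * (w - (x +i* y : C))) <= e / 4 * cn (w - (x +i* y : C)).
  by apply: Dl; lra.
exists r => // a b c d /andP[xa ax] /andP[xb bx] /andP[yc cy] /andP[yd dy] small.
set z := (x +i* y : C) in Hr; set D := b - a + (d - c).
pose al := g z - l * z.
have D0 : 0 <= D by rewrite /D; lra.
have near u v : a <= u <= b -> c <= v <= d ->
    cn (g (u +i* v) - (al + l * (u +i* v : C))) <= e / 4 * D.
  move=> uab vcd.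
  have uvD : cn ((u +i* v : C) - z) <= D.
    apply: le_trans (cn_le_ReIm _) _.
    by rewrite !(reD, reN, imD, imN)/= /D lerD// ler_norml; lra.
  have := Hr _ (le_lt_trans uvD small).
  rewrite (_ : _ - _ - _ = g (u +i* v) - (al + l * (u +i* v : C))); last first.
    by rewrite /al; ring.
  move/le_trans; apply; rewrite ler_pM2l//; lra.
have hor v : c <= v <= d -> cn (H v b - H v a - (b - a)%:C *
    ((al + l * (ci * v%:C)) + l * ((a + b) / 2)%:C)) <= 2 * (e / 4 * D) * (b - a).
  move=> vcd; apply: (@cprim_near_affine _ (fun t => g (t +i* v))); first by lra.
    by apply: (@cprim_sub _ _ _ x0 x1) => //; apply: HH; lra.
  move=> t tab; have := near t v tab vcd; rewrite complex_addi.
  by rewrite mulrDr (addrC (l * t%:C)) addrA.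
have ver u : a <= u <= b -> cn (V u d - V u c - (d - c)%:C *
    ((al + l * u%:C) + (l * ci) * ((c + d) / 2)%:C)) <= 2 * (e / 4 * D) * (d - c).
  move=> uab; apply: (@cprim_near_affine _ (fun t => g (u +i* t))); first by lra.
    by apply: (@cprim_sub _ _ _ y0 y1) => //; apply: HV; lra.
  move=> t tcd; have := near u t uab tcd; rewrite complex_addi.
  by rewrite mulrDr addrA (mulrA l).
have c1 : c <= c <= d by lra.
have c2 : c <= d <= d by lra.
have a1 : a <= a <= b by lra.
have a2 : a <= b <= b by lra.
move: (hor c c1) (hor d c2) (ver a a1) (ver b a2).
set h1 := (X in cn X <= _); set h2 := (X in _ -> cn X <= _ -> _).
set v1 := (X in _ -> _ -> cn X <= _ -> _); set v2 := (X in _ -> _ -> _ -> cn X <= _ -> _).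
move=> H1 H2 V1 V2.
have -> : mu a b c d = h1 + ci * v2 - h2 - ci * v1.
  rewrite /mu /h1 /h2 /v1 /v2; ring.
have t1 := cnB (h1 + ci * v2 - h2) (ci * v1).
have t2 := cnB (h1 + ci * v2) h2.
have t3 := cnD h1 (ci * v2).
rewrite !cnM cn_ci !mul1r in t1 t2 t3.
have -> : e * D ^+ 2 = 2 * (e / 4 * D) * (b - a) + 2 * (e / 4 * D) * (b - a) +
   (2 * (e / 4 * D) * (d - c) + 2 * (e / 4 * D) * (d - c)) by rewrite /D; field.
lra.
Qed.

End Goursat.

(** * A Cauchy estimate for the derivative *)

Section DerivativeRules.
Variable R : realType.
Notation C := (Cplx R).
Implicit Types (f g : C -> C) (z w l c : C) (x y e M : R).

Lemma cderD f g z l k : cder f z l -> cder g z k -> cder (fun w => f w + g w) z (l + k).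
Proof.
move=> df dg e e0; have e20 : 0 < e / 2 by lra.
have [d1 d10 H1] := df _ e20; have [d2 d20 H2] := dg _ e20.
exists (Num.min d1 d2); first by rewrite lt_min d10.
move=> w; rewrite lt_min => /andP[/H1 h1 /H2 h2].
rewrite (_ : _ - _ - _ = (f w - f z - l * (w - z)) + (g w - g z - k * (w - z))); last by ring.
by apply: le_trans (cnD _ _) _; lra.
Qed.

Lemma cderZ f z l c : cder f z l -> cder (fun w => c * f w) z (c * l).
Proof.
move=> df e e0; have c0 := cn_ge0 c; have K0 : 0 < 1 + cn c by lra.
have [d d0 H] := df _ (divr_gt0 e0 K0); exists d => // w /H h.
rewrite (_ : _ - _ - _ = c * (f w - f z - l * (w - z))); last by ring.
rewrite cnM; have h0 := cn_ge0 (w - z).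
apply: (@le_trans _ _ (cn c * (e / (1 + cn c) * cn (w - z)))).
  by rewrite ler_wpM2l.
rewrite mulrA ler_wpM2r// mulrCA ger_pMr// ler_pdivrMr//; lra.
Qed.

Lemma cderM f g z l k : cder f z l -> cder g z k ->
  cder (fun w => f w * g w) z (f z * k + l * g z).
Proof.
move=> df dg e e0.
pose K := 1 + cn (f z) + cn k + cn (g z).
have f0 := cn_ge0 (f z); have k0 := cn_ge0 k; have g0 := cn_ge0 (g z).
have K0 : 0 < K by rewrite /K; lra.
pose e1 := Num.min 1 (e / (4 * K)).
have e10 : 0 < e1 by rewrite lt_min ltr01 divr_gt0//; lra.
have e1le : e1 <= 1 by rewrite ge_min lexx.
have e1K : e1 * (4 * K) <= e by rewrite -ler_pdivlMr ?ge_min ?lexx ?orbT//; lra.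
have [d1 d10 H1] := df _ e10; have [d2 d20 H2] := dg _ e10.
have [d3 d30 H3] := cder_continuous df e10.
exists (Num.min d1 (Num.min d2 d3)); first by rewrite !lt_min d10 d20.
move=> w; rewrite !lt_min => /and3P[/H1 h1 /H2 h2 /H3 h3].
rewrite (_ : _ - _ - _ = (f w - f z) * (g w - g z - k * (w - z))
  + f z * (g w - g z - k * (w - z)) + (f w - f z) * (k * (w - z))
  + g z * (f w - f z - l * (w - z))); last by ring.
apply: le_trans (cnD _ _) _; apply: le_trans (lerD (cnD _ _) (lexx _)) _.
apply: le_trans (lerD (lerD (cnD _ _) (lexx _)) (lexx _)) _; rewrite !cnM.
move: (cn_ge0 (w - z)) (cn_ge0 (f w - f z)) h1 h2 h3.
move: (cn (w - z)) (cn (f w - f z)) (cn (f w - f z - _)) (cn (g w - _ - _)).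
move=> D F A B D0 F0 h1 h2 h3.
have b1 : F * B <= e1 * D.
  apply: le_trans (ler_wpM2l F0 h2) _; rewrite mulrA; apply: ler_wpM2r => //; nra.
have b2 : cn (f z) * B <= cn (f z) * (e1 * D) by apply: ler_wpM2l.
have b3 : F * (cn k * D) <= e1 * (cn k * D) by apply: ler_wpM2r => //; exact: mulr_ge0.
have b4 : cn (g z) * A <= cn (g z) * (e1 * D) by apply: ler_wpM2l.
have : e1 * (4 * K) * D <= e * D by apply: ler_wpM2r.
have : 0 <= e1 * D by rewrite mulr_ge0// ltW.
rewrite /K; nra.
Qed.

Lemma cderV z : z != 0 -> cder (fun w => w^-1) z (- (z * z)^-1).
Proof.
move=> z0 e e0; have n0 := cn_gt0 z0.
have n3 : 0 < e * cn z ^+ 3 / 2 by rewrite divr_gt0// mulr_gt0// exprn_gt0.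
exists (Num.min (cn z / 2) (e * cn z ^+ 3 / 2)); first by rewrite lt_min n3 divr_gt0.
move=> w; rewrite lt_min => /andP[h1 h2].
have wn : cn z / 2 <= cn w.
  have := cnB w (w - z); rewrite (_ : w - (w - z) = z); [lra|ring].
have w0 : w != 0 by apply: contraTneq wn => ->; rewrite cn0; lra.
rewrite (_ : _ - _ - _ = (w - z) * ((w - z) / (w * (z * z)))); last by field; rewrite z0 w0.
rewrite cnM mulrC ler_wpM2r ?cn_ge0// cnM cnV !cnM ler_pdivrMr; last first.
  by rewrite !mulr_gt0//; lra.
apply: le_trans (ltW h2) _.
rewrite (_ : e * cn z ^+ 3 / 2 = e * (cn z / 2 * (cn z * cn z))); last by field.
by rewrite ler_pM2l// ler_wpM2r// mulr_ge0 ?cn_ge0.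
Qed.

Lemma cder_affine f z l c b : cder f (c * z + b) l -> cder (fun w => f (c * w + b)) z (c * l).
Proof.
move=> df e e0; have c0 := cn_ge0 c; have K0 : 0 < 1 + cn c by lra.
have [d d0 H] := df _ (divr_gt0 e0 K0); exists (d / (1 + cn c)); first exact: divr_gt0.
move=> w; rewrite ltr_pdivlMr// => wd; have w0 := cn_ge0 (w - z).
have E : c * w + b - (c * z + b) = c * (w - z) by ring.
have := H (c * w + b); rewrite E cnM.
rewrite (_ : l * (c * (w - z)) = c * l * (w - z)); last by ring.
move=> /(_ _)/le_trans; apply; first by nra.
rewrite mulrA ler_wpM2r// mulrAC -mulrA ger_pMr// ler_pdivrMr//; lra.
Qed.

Lemma cder_ext f g z l : f =1 g -> cder f z l -> cder g z l.
Proof. by move=> /funext ->. Qed.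

Lemma cder_id z : cder id z 1.
Proof.
by move=> e e0; exists 1 => // w _; rewrite mul1r subrr cn0 mulr_ge0 ?cn_ge0// ltW.
Qed.

End DerivativeRules.

Section WeakCauchy.
Variable R : realType.
Notation C := (Cplx R).
Implicit Types (f g : C -> C) (z w l c : C) (x y e M : R).

(** The component [h] of [f] with [h ('i z) = 'i h z]; it has the derivative of
[f] at 0. Dividing by the square of z then gives a differential form g(z) dz that
is invariant under quarter turns. *)
Definition symmetrise f z : C := (f z - ci * f (ci * z) - f (- z) + ci * f (- (ci * z))) / 4.

Lemma symmetrise_rot f z : symmetrise f (ci * z) = ci * symmetrise f z.
Proof.
rewrite /symmetrise (_ : ci * (ci * z) = - z) ?opprK; last by rewrite mulrA sqr_ci mulN1r.
by ring: (sqr_ci R).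
Qed.

Lemma symmetrise0 f : symmetrise f 0 = 0.
Proof. by rewrite /symmetrise mulr0 oppr0; ring. Qed.

Lemma symmetrise_cder f z l1 l2 l3 l4 : cder f z l1 -> cder f (ci * z) l2 ->
  cder f (- z) l3 -> cder f (- (ci * z)) l4 ->
  cder (symmetrise f) z ((l1 + l2 + l3 + l4) / 4).
Proof.
move=> d1 d2 d3 d4.
have [e2 e3 e4] : [/\ ci * z = ci * z + 0, - z = -1 * z + 0 & - (ci * z) = - ci * z + 0].
  by split; ring.
rewrite e2 in d2; rewrite e3 in d3; rewrite e4 in d4.
have D1 := cderZ (- ci) (cder_affine d2).
have D2 := cderZ (-1) (cder_affine d3).
have D3 := cderZ ci (cder_affine d4).
have := cderZ (4^-1) (cderD (cderD (cderD d1 D1) D2) D3).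
rewrite (_ : 4^-1 * _ = (l1 + l2 + l3 + l4) / 4); last first.
  rewrite mulrC; congr (_ / 4); ring: (sqr_ci R).
apply: cder_ext => w; rewrite /symmetrise [LHS]mulrC; congr (_ / 4).
by rewrite !addr0 !mulN1r !mulNr.
Qed.

Lemma symmetrise_bound f z M : (forall w, cn w = cn z -> cn (f w) <= M) ->
  cn (symmetrise f z) <= M.
Proof.
move=> H; have iz : cn (ci * z) = cn z by rewrite cnM cn_ci mul1r.
have h1 := H z erefl; have h2 := H _ iz.
have h3 := H (- z) (cnN _); have h4 : cn (f (- (ci * z))) <= M by apply: H; rewrite cnN.
rewrite /symmetrise cnM cnV (_ : cn 4 = 4); last first.
  by rewrite (_ : 4 = (4 : R)%:C) ?cn_real ?ger0_norm// rmorph_nat.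
rewrite ler_pdivrMr//; apply: le_trans (cnD _ _) _; rewrite cnM cn_ci mul1r.
apply: le_trans (lerD (cnB _ _) (lexx _)) _.
apply: le_trans (lerD (lerD (cnB _ _) (lexx _)) (lexx _)) _; rewrite cnM cn_ci mul1r.
lra.
Qed.

Lemma horizontal_prim g a b y :
  (forall x, a <= x <= b -> exists l, cder g (x +i* y) l) ->
  exists P, cprim (fun t => g (t +i* y)) P a b.
Proof.
move=> dg; apply: cprim_ex => x xab e e0; have [l Dl] := dg x xab.
have [d d0 Hd] := cder_continuous Dl e0; exists d => // t _ tx; apply: Hd.
rewrite (_ : (t +i* y : C) - (x +i* y) = (t - x)%:C) ?cn_real//.
by apply/eqP; rewrite eq_complex/= subrr !eqxx.
Qed.

Lemma vertical_prim g a b x :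
  (forall y, a <= y <= b -> exists l, cder g (x +i* y) l) ->
  exists P, cprim (fun t => g (x +i* t)) P a b.
Proof.
move=> dg; apply: cprim_ex => y yab e e0; have [l Dl] := dg y yab.
have [d d0 Hd] := cder_continuous Dl e0; exists d => // t _ ty; apply: Hd.
rewrite (_ : (x +i* t : C) - (x +i* y) = ci * (t - y)%:C) ?cnM ?cn_ci ?mul1r ?cn_real//.
by apply/eqP; rewrite eq_complex/=; apply/andP; split; apply/eqP; ring.
Qed.

Lemma quotient_sub_inv (u v : C) : v != 0 ->
  u * (v^-1 * v^-1) - v^-1 = (u - v) * (v^-1 * v^-1).
Proof. by move=> v0; field. Qed.

Lemma im_inv_le x y : 0 < y -> - y <= x <= y -> im ((x +i* y : C)^-1) <= - (1 / (2 * y)).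
Proof.
move=> y0 xy; rewrite (_ : im _ = - (y / (x ^+ 2 + y ^+ 2)))// lerN2.
have s0 : 0 < x ^+ 2 + y ^+ 2 by rewrite ltr_wpDl ?sqr_ge0// exprn_gt0.
rewrite ler_pdivlMr// mulrAC ler_pdivrMr ?mulr_gt0//; nra.
Qed.

(** Let h be the symmetrised f and g(z) = h(z) / z^2. Goursat's theorem is applied to
g on [-ep, 1] x [ep, 1]. This rectangle and its three quarter turns tile the
square annulus between the squares of half sides ep and 1; by the invariance of
g(z) dz its left side cancels against part of its bottom side, so one rectangle
suffices. What remains says that the integral of g over the inner side from
-ep + i ep to ep + i ep equals an integral over the outer sides. As g is close to
1 / z near 0, the inner integral has imaginary part at most -3/4, while the outer
one is bounded by 2 M. *)
Lemma weak_cauchy_normalised f M :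
  (forall z, cn z < 2 -> exists l, cder f z l) -> (forall z, cn z < 2 -> cn (f z) <= M) ->
  cder f 0 1 -> 3 / 8 <= M.
Proof.
move=> Df Mf Df0.
pose h := symmetrise f.
have Dh z : cn z < 2 -> exists l, cder h z l.
  move=> z2; have iz : cn (ci * z) < 2 by rewrite cnM cn_ci mul1r.
  have [l1 d1] := Df z z2; have [l2 d2] := Df _ iz.
  have [|l3 d3] := Df (- z); first by rewrite cnN.
  have [|l4 d4] := Df (- (ci * z)); first by rewrite cnN.
  by exists ((l1 + l2 + l3 + l4) / 4); exact: symmetrise_cder.
have Mh z : cn z < 2 -> cn (h z) <= M.
  by move=> z2; apply: symmetrise_bound => w wz; apply: Mf; rewrite wz.
have Dh0 : cder h 0 1.
  rewrite (_ : 1 = (1 + 1 + 1 + 1) / 4); last by field.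
  by apply: symmetrise_cder; rewrite ?mulr0 ?oppr0.
have e8 : (0 : R) < 1 / 8 by lra.
have [d d0 Hd] := Dh0 _ e8.
pose ep := Num.min (1 / 2) (d / 4).
have ep0 : 0 < ep by rewrite lt_min; lra.
have ep1 : ep <= 1 / 2 by rewrite ge_min lexx.
have epd : 2 * ep < d.
  have : ep <= d / 4 by rewrite ge_min lexx orbT.
  lra.
pose g z := h z * (z^-1 * z^-1).
(* The invariance of g(z) dz under z |-> i z. *)
have gi z : ci * g (ci * z) = g z.
  rewrite /g /h symmetrise_rot invfM.
  have -> : (ci : C)^-1 = - ci.
    have c0 : (ci : C) != 0 by rewrite eq_complex/= negb_and oner_eq0 orbT.
    by apply: (mulfI c0); rewrite mulfV// mulrN sqr_ci opprK.
  move: (symmetrise f z) (z^-1) => u v; rewrite (_ : _ * _ = (ci * ci) * (ci * ci) * (u * (v * v))).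
    by rewrite sqr_ci; ring.
  by ring.
have in2 x y : - ep <= x <= 1 -> ep <= y <= 1 -> cn (x +i* y : C) < 2.
  move=> hx hy; rewrite -(@ltr_pXn2r _ 2) ?nnegrE ?cn_ge0// sqr_cn/=; nra.
have Dg x y : - ep <= x <= 1 -> ep <= y <= 1 -> exists l, cder g (x +i* y) l.
  move=> hx hy; have [l Dl] := Dh _ (in2 x y hx hy).
  have z0 : (x +i* y : C) != 0 by rewrite eq_complex/= negb_and (gt_eqF (_ : 0 < y)) ?orbT//; lra.
  by eexists; apply: cderM Dl (cderM (cderV z0) (cderV z0)).
have /choice[H HH] : forall y, exists P, ep <= y <= 1 -> cprim (fun t => g (t +i* y)) P (- ep) 1.
  move=> y.
  have [hy|hy] := boolP (ep <= y <= 1); last by exists (fun=> 0).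
  have [P HP] := @horizontal_prim g (- ep) 1 y (fun x hx => Dg x y hx hy).
  by exists P.
have /choice[V HV] : forall x, exists P, - ep <= x <= 1 -> cprim (fun t => g (x +i* t)) P ep 1.
  move=> x.
  have [hx|hx] := boolP (- ep <= x <= 1); last by exists (fun=> 0).
  have [P HP] := @vertical_prim g ep 1 x (fun y hy => Dg x y hx hy).
  by exists P.
have em : - ep <= 1 by lra.
have e1 : ep <= 1 by lra.
have G := goursat em e1 Dg HH HV.
have le1 : ep <= 1 <= (1 : R) by rewrite e1 lexx.
have lee : ep <= ep <= 1 by rewrite lexx.
have lm1 : - ep <= 1 <= (1 : R) by rewrite em lexx.
have lme : - ep <= - ep <= 1 by rewrite lexx.
(* The left side is the quarter turn of the part [ep, 1] of the bottom side. *)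
have cancel : ci * V (- ep) 1 - ci * V (- ep) ep = H ep 1 - H ep ep.
  apply: (@cprim_unique _ (fun t => g (t +i* ep)) (fun t => ci * V (- ep) t)) => //.
    have := cprim_muli (HV (- ep) lme).
    rewrite (_ : (fun t => ci * g (- ep +i* t)) = (fun t => g (t +i* ep)))//.
    apply/funext => t; rewrite -(gi (t +i* ep)); congr (ci * g _).
    by apply/eqP; rewrite eq_complex/= !mul0r !mul1r sub0r add0r !eqxx.
  by apply: (@cprim_sub _ _ _ (- ep) 1) => //; [lra|exact: HH].
have key : H ep ep - H ep (- ep) = (H 1 1 - H 1 (- ep)) - ci * (V 1 1 - V 1 ep).
  apply/eqP; rewrite -subr_eq0 -[X in _ == X]G; apply/eqP.
  rewrite [X in _ = _ - X]mulrBr cancel; ring.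
have Mg x y : - ep <= x <= 1 -> ep <= y <= 1 -> 1 <= cn (x +i* y : C) -> cn (g (x +i* y)) <= M.
  move=> hx hy h1; have := Mh _ (in2 x y hx hy).
  rewrite /g (cnM (h _)) (cnM _^-1) cnV -invfM; move: (cn (h _)) (cn_ge0 (h (x +i* y))) => m m0 mM.
  have M0 := le_trans m0 mM.
  have h2 : 1 <= cn (x +i* y : C) * cn (x +i* y : C) by apply: mulr_ege1.
  rewrite ler_pdivrMr ?(lt_le_trans ltr01 h2)//; apply: le_trans mM _.
  by rewrite ler_peMr.
(* Im (1/z) <= -1/(2 ep) on the inner side, and |g - 1/z| <= 1/(8 ep) there. *)
have inner : im (H ep ep) - im (H ep (- ep)) <= (ep - - ep) * (- (3 / (8 * ep)) + 0 * ((- ep + ep) / 2)).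
  have [_ HI] : cprim (fun t => g (t +i* ep)) (H ep) (- ep) ep.
    by apply: (@cprim_sub _ _ _ (- ep) 1) => //; exact: HH.
  apply: (rprim_le_affine _ HI) => [|x hx]; first by lra.
  set w := (x +i* ep : C).
  have wl : ep <= cn w by have := Im_le_cn w; rewrite /= ger0_norm//; exact: ltW.
  have w0 : w != 0 by rewrite eq_complex/= negb_and (gt_eqF ep0) orbT.
  have wu : cn w < d.
    have := cn_le_ReIm w; rewrite /= (ger0_norm (ltW ep0)).
    have : `|x| <= ep by rewrite ler_norml.
    lra.
  have := Hd w; rewrite subr0 mul1r [h 0]symmetrise0 subr0 => /(_ wu) hw.
  have gw : cn (g w - w^-1) <= 1 / (8 * ep).
    rewrite (_ : g w - w^-1 = (h w - w) * (w^-1 * w^-1)); last exact: quotient_sub_inv.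
    have cw0 : 0 < cn w by lra.
    rewrite !cnM !cnV -invfM ler_pdivrMr ?mulr_gt0//.
    rewrite mulrAC ler_pdivlMr ?mulr_gt0//; nra.
  have iw : im (w^-1) <= - (1 / (2 * ep)).
    by apply: im_inv_le.
  have := Im_le_cn (g w - w^-1); rewrite imD imN ler_norml => /andP[_ hi].
  rewrite mul0r addr0.
  have -> : - (3 / (8 * ep)) = - (1 / (2 * ep)) + 1 / (8 * ep) by field; rewrite gt_eqF.
  rewrite /w in hi gw iw *; lra.
have outH : - im (H 1 1) - - im (H 1 (- ep)) <= (1 - - ep) * (M + 0 * ((- ep + 1) / 2)).
  have [_ /rprimN HI] := HH 1 le1.
  apply: (rprim_le_affine em HI) => x hx; rewrite mul0r addr0.
  have w1 : 1 <= cn (x +i* 1 : C) by have := Im_le_cn (x +i* 1); rewrite /= normr1.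
  have := Im_le_cn (g (x +i* 1)); rewrite ler_norml.
  have := Mg _ _ hx le1 w1; lra.
have outV : re (V 1 1) - re (V 1 ep) <= (1 - ep) * (M + 0 * ((ep + 1) / 2)).
  have [HI _] := HV 1 lm1.
  apply: (rprim_le_affine e1 HI) => y hy; rewrite mul0r addr0.
  have w1 : 1 <= cn (1 +i* y : C) by have := Re_le_cn (1 +i* y); rewrite /= normr1.
  have := Re_le_cn (g (1 +i* y)); rewrite ler_norml.
  have := Mg _ _ lm1 hy w1; lra.
have := congr1 (@complex.Im R) key.
rewrite !(imD, imN, imM, reD, reN)/= mul0r mul1r add0r => E.
have Ei : (ep - - ep) * (- (3 / (8 * ep)) + 0 * ((- ep + ep) / 2)) = - (3 / 4).
  by field; rewrite gt_eqF.
rewrite Ei in inner; lra.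
Qed.

End WeakCauchy.

(** * Lipschitz and second order estimates for bounded functions *)

Section CauchyEstimates.
Variable R : realType.
Notation C := (Cplx R).
Implicit Types (f g : C -> C) (z w l c : C) (x y e M L rho : R).

Definition cdiff_on f rho := forall z, cn z < rho -> exists l, cder f z l.

(** The normalised case, applied to z |-> f (rho z / 2) divided by its derivative
at 0. *)
Lemma cauchy_estimate f l rho M : 0 < rho -> cdiff_on f rho ->
  (forall z, cn z < rho -> cn (f z) <= M) -> cder f 0 l -> cn l <= 6 * M / rho.
Proof.
move=> rho0 df Mf dl.
have M0 : 0 <= M by apply: le_trans (cn_ge0 _) (Mf 0 _); rewrite cn0.
have [->|l0] := eqVneq l 0; first by rewrite cn0 divr_ge0 ?mulr_ge0// ltW.
have nl0 := cn_gt0 l0.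
pose c : C := (rho / 2)%:C.
have cc : cn c = rho / 2 by rewrite cn_real ger0_norm//; lra.
have c0 : c != 0 by apply/eqP => c0; move: cc; rewrite c0 cn0; lra.
pose F z := (l * c)^-1 * f (c * z + 0).
have scale z : cn z < 2 -> cn (c * z + 0) < rho.
  by rewrite addr0 cnM cc => z2; rewrite mulrAC ltr_pdivrMr// ltr_pM2l.
have : 3 / 8 <= M / (cn l * (rho / 2)).
  apply: (@weak_cauchy_normalised R F).
- move=> z z2; have [k Dk] := df _ (scale z z2); eexists.
  exact/cderZ/cder_affine/Dk.
- move=> z z2; rewrite /F cnM cnV cnM cc mulrC ler_pM2r ?Mf ?scale//.
  by rewrite invr_gt0 mulr_gt0//; lra.
- rewrite (_ : 1 = (l * c)^-1 * (c * l)); last by rewrite (mulrC c) mulVf ?mulf_neq0.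
  by apply: cderZ; apply: cder_affine; rewrite mulr0 addr0.
move=> H; have : 3 / 8 * (cn l * (rho / 2)) <= M.
  by rewrite -ler_pdivlMr// mulr_gt0//; lra.
rewrite ler_pdivlMr//; nra.
Qed.

Lemma is_derive_eps (u : R -> R) x (l : R) :
  (forall e, 0 < e -> exists2 d, 0 < d & forall y, `|y - x| < d ->
     `|u y - u x - l * (y - x)| <= e * `|y - x|) -> is_derive x 1 u l.
Proof.
move=> H.
have D : h^-1 *: (u (h *: 1 + x) - u x) @[h --> 0^'] --> l.
  apply/cvgrPdist_le => e e0; have [d d0 Hd] := H e e0.
  near=> h.
  have h0 : h != 0 by near: h; exact: nbhs_dnbhs_neq.
  have hd : `|h| < d by near: h; exact: dnbhs0_lt.
  have := Hd (h + x); rewrite addrK => /(_ hd) hh.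
  rewrite /GRing.scale/= mulr1.
  rewrite (_ : _ - _ = - (h^-1 * (u (h + x) - u x - l * h))); last by field.
  by rewrite normrN normrM normfV ler_pdivrMl ?normr_gt0// (mulrC `|h|).
by apply: DeriveDef; [apply/cvg_ex; exists l|apply/cvg_lim].
Unshelve. all: by end_near. Qed.

(** The real mean value theorem for the real and imaginary parts of f along the
segment; hence the factor 2. *)
Lemma mean_value_ineq f z w L :
  (forall t : R, 0 <= t <= 1 -> exists2 l, cder f (w + t%:C * (z - w)) l & cn l <= L) ->
  cn (f z - f w) <= 2 * L * cn (z - w).
Proof.
move=> H.
have : forall t : R, exists l, 0 <= t <= 1 -> cder f (w + t%:C * (z - w)) l /\ cn l <= L.
  move=> t; have [/H[l d b]|_] := boolP (0 <= t <= 1); first by exists l.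
  by exists 0.
move=> /choice[l Hl].
pose gam (t : R) := f (w + t%:C * (z - w)).
have der (t : R) : 0 <= t <= 1 -> forall e, 0 < e -> exists2 d, 0 < d & forall s : R, `|s - t| < d ->
    cn (gam s - gam t - (l t * (z - w)) * (s - t)%:C) <= e * `|s - t|.
  move=> /Hl[D _] e e0; have n0 := cn_ge0 (z - w).
  have K0 : 0 < 1 + cn (z - w) by lra.
  have [d d0 Hd] := D _ (divr_gt0 e0 K0).
  exists (d / (1 + cn (z - w))); first exact: divr_gt0.
  move=> s; rewrite ltr_pdivlMr// => sd.
  have E : w + s%:C * (z - w) - (w + t%:C * (z - w)) = (s - t)%:C * (z - w).
    by rewrite rmorphB/=; ring.
  have s0 := normr_ge0 (s - t).
  have sd' : `|s - t| * cn (z - w) < d by nra.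
  have := Hd (w + s%:C * (z - w)); rewrite E cnM cn_real => /(_ sd').
  rewrite (_ : l t * ((s - t)%:C * (z - w)) = l t * (z - w) * (s - t)%:C); last by ring.
  move/le_trans; apply; rewrite [leLHS]mulrCA mulrC ler_wpM2r//.
  by rewrite mulrAC -mulrA ger_pMr// ler_pdivrMr//; lra.
have mvt (p : C -> R) : (forall u v, p (u - v) = p u - p v) ->
    (forall (r : R) (u : C), p (u * r%:C) = p u * r) -> (forall u, `|p u| <= cn u) ->
    `|p (f z - f w)| <= L * cn (z - w).
  move=> pB pZ pn.
  have dp (t : R) : 0 <= t <= 1 -> is_derive t 1 (p \o gam) (p (l t * (z - w))).
    move=> t01; apply: is_derive_eps => e e0; have [d d0 Hd] := der t t01 e e0.
    by exists d => // s /Hd; apply: le_trans; rewrite /= -pZ -!pB.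
  have cp : {within `[0, 1], continuous (p \o gam)}.
    apply: derivable_within_continuous => t; rewrite in_itv/= => /dp Dt.
    exact: ex_derive.
  have [||c] := @MVT_segment _ (p \o gam) (fun t => p (l t * (z - w))) 0 1 ler01.
  - by move=> t; rewrite in_itv/= => /andP[t0 t1]; apply: dp; rewrite !ltW.
  - exact: cp.
  have g1 : gam 1 = f z by rewrite /gam rmorph1 mul1r addrC subrK.
  have g0 : gam 0 = f w by rewrite /gam rmorph0 mul0r addr0.
  rewrite in_itv/= g1 g0 subr0 mulr1 pB => /Hl[_ lL] ->.
  by apply: le_trans (pn _) _; rewrite cnM ler_wpM2r// cn_ge0.
have := cn_le_ReIm (f z - f w).
have h1 : `|re (f z - f w)| <= L * cn (z - w).
  apply: mvt; [by move=> u v; rewrite reD reN| |exact: Re_le_cn].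
  by move=> r u; rewrite reM/= mulr0 subr0.
have h2 : `|im (f z - f w)| <= L * cn (z - w).
  apply: mvt; [by move=> u v; rewrite imD imN| |exact: Im_le_cn].
  by move=> r u; rewrite imM/= mulr0 add0r.
lra.
Qed.

Lemma cauchy_estimate_at f l z rho sig M : 0 < sig -> cn z + sig <= rho -> cdiff_on f rho ->
  (forall z, cn z < rho -> cn (f z) <= M) -> cder f z l -> cn l <= 6 * M / sig.
Proof.
move=> sig0 zs df Mf dl.
have E w : w + z = 1 * w + z by rewrite mul1r.
have inb w : cn w < sig -> cn (1 * w + z) < rho.
  by move=> ws; apply: le_lt_trans (cnD _ _) _; rewrite mul1r; lra.
apply: (@cauchy_estimate (fun w => f (1 * w + z))) => //.
- move=> w ws; have [k Dk] := df _ (inb w ws); eexists; exact: cder_affine Dk.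
- by move=> w ws; apply/Mf/inb.
- by rewrite -(mul1r l); apply: cder_affine; rewrite mulr0 add0r.
Qed.

Lemma bounded_lipschitz f rho M z w : 0 < rho -> cdiff_on f rho ->
  (forall z, cn z < rho -> cn (f z) <= M) -> cn z < rho / 2 -> cn w < rho / 2 ->
  cn (f z - f w) <= 24 * M / rho * cn (z - w).
Proof.
move=> rho0 df Mf zr wr.
rewrite (_ : 24 * M / rho = 2 * (6 * M / (rho / 2))); last by field; rewrite gt_eqF.
apply: mean_value_ineq => t /andP[t0 t1].
have seg : cn (w + t%:C * (z - w)) < rho / 2.
  rewrite (_ : _ + _ = (1 - t)%:C * w + t%:C * z); last by rewrite rmorphB rmorph1; ring.
  apply: le_lt_trans (cnD _ _) _; rewrite !cnM !cn_real !ger0_norm//; last by lra.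
  apply: (@le_lt_trans _ _ (Num.max (cn w) (cn z))); last by rewrite gt_max wr.
  have m1 : cn w <= Num.max (cn w) (cn z) by rewrite le_max lexx.
  have m2 : cn z <= Num.max (cn w) (cn z) by rewrite le_max lexx orbT.
  nra.
have [|l Dl] := df (w + t%:C * (z - w)); first by lra.
by exists l => //; apply: (cauchy_estimate_at _ _ df Mf Dl); lra.
Qed.

(** The Cauchy estimate, applied to w |-> f (w + z) - f w, shows that f' moves by
at most a multiple of |z| between 0 and z, since this function is O(|z|) by
[bounded_lipschitz]. Then the mean value inequality applies to f - l z. *)
Lemma bounded_taylor f rho M l h : 0 < rho -> cdiff_on f rho ->
  (forall z, cn z < rho -> cn (f z) <= M) -> cder f 0 l -> cn h < rho / 4 ->
  cn (f h - f 0 - l * h) <= 1152 * M / rho ^+ 2 * cn h ^+ 2.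
Proof.
move=> rho0 df Mf dl hr.
have M0 : 0 <= M by apply: le_trans (cn_ge0 _) (Mf 0 _); rewrite cn0.
have h0 := cn_ge0 h.
(* 576 = 6 * 24 * 4: the Cauchy estimate on the disc of radius rho / 4, for a
   function bounded by [bounded_lipschitz]. *)
pose K := 576 * M / rho ^+ 2.
have r2 : 0 < rho ^+ 2 by rewrite exprn_gt0.
have K0 : 0 <= K by apply: mulr_ge0; [exact: mulr_ge0 (ler0n _ _) M0|rewrite invr_ge0 ltW].
have dl_near z k : cn z <= cn h -> cder f z k -> cn (k - l) <= K * cn h.
  move=> zh dk; have z0 := cn_ge0 z.
  pose g w := f (1 * w + z) + -1 * f w.
  have dg : cder g 0 (1 * k + -1 * l).
    by apply: cderD; [apply: cder_affine; rewrite mulr0 add0r|exact: cderZ].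
  have r4 : 0 < rho / 4 by lra.
  have : cn (1 * k + -1 * l) <= 6 * (24 * M / rho * cn z) / (rho / 4).
    apply: (@cauchy_estimate g) => //.
  - move=> w wr; have [|k1 D1] := df (1 * w + z).
      by apply: le_lt_trans (cnD _ _) _; rewrite mul1r; lra.
    have [|k2 D2] := df w; first by lra.
    eexists; apply: cderD; [exact: cder_affine D1|exact: cderZ D2].
  - move=> w wr; rewrite /g mulN1r.
    rewrite [X in _ * cn X](_ : z = 1 * w + z - w); last by ring.
    apply: (@bounded_lipschitz f rho M) => //; last by lra.
    by apply: le_lt_trans (cnD _ _) _; rewrite mul1r; lra.
  rewrite mul1r mulN1r => /le_trans; apply.
  rewrite (_ : _ / _ = K * cn z); last by rewrite /K; field; rewrite gt_eqF.
  exact: ler_wpM2l.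
pose F z := f z + - l * z.
rewrite (_ : f h - f 0 - l * h = F h - F 0); last by rewrite /F; ring.
rewrite (_ : _ * _ = 2 * (K * cn h) * cn (h - 0)); last first.
  by rewrite /K subr0; field; rewrite gt_eqF.
apply: mean_value_ineq => t /andP[t0 t1]; rewrite add0r subr0.
have th : cn (t%:C * h) <= cn h by rewrite cnM cn_real ger0_norm// ler_piMl.
have [|k Dk] := df (t%:C * h); first by lra.
exists (k + - l * 1); first by apply: cderD => //; apply: cderZ; exact: cder_id.
by rewrite mulr1; apply: dl_near Dk.
Qed.

End CauchyEstimates.

(** * The Euclidean norm and complex differentiability of maps *)

Lemma enorm_ge0 (R : realType) (k : nat) (v : 'rV[Cplx R]_k) : 0 <= enorm v.
Proof. exact: sqrtr_ge0. Qed.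
#[local] Hint Extern 0 (is_true (0 <= enorm _)) => solve [apply: enorm_ge0] : core.

Section Enorm.
Variables (R : realType) (k : nat).
Notation C := (Cplx R).
Notation V := 'rV[Cplx R]_k.
Notation N := (@enorm R k).
Implicit Types (u v z w : V) (c : C) (e d : R).

Lemma sqr_enorm v : N v ^+ 2 = \sum_(i < k) cn (v ord0 i) ^+ 2.
Proof. by rewrite sqr_sqrtr// sumr_ge0// => i _; rewrite sqr_ge0. Qed.

Lemma enorm0 : N 0 = 0.
Proof.
rewrite /enorm big1 ?sqrtr0// => i _.
by rewrite mxE cn0 expr0n.
Qed.

Lemma cn_le_enorm v i : cn (v ord0 i) <= N v.
Proof.
rewrite -(@ler_pXn2r _ 2) ?nnegrE ?cn_ge0// sqr_enorm (bigD1 i)//= lerDl.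
by rewrite sumr_ge0// => j _; rewrite sqr_ge0.
Qed.

Lemma enorm_le_coord v (B : R) : 0 <= B -> (forall i, cn (v ord0 i) <= B) -> N v <= k%:R * B.
Proof.
move=> B0 H; rewrite -(@ler_pXn2r _ 2) ?nnegrE ?mulr_ge0 ?ler0n// sqr_enorm.
apply: (@le_trans _ _ (\sum_(i < k) B ^+ 2)).
  by apply: ler_sum => i _; rewrite ler_pXn2r ?nnegrE ?cn_ge0.
rewrite sumr_const card_ord exprMn -(mulr_natl (B ^+ 2)) ler_wpM2r ?sqr_ge0//.
by rewrite -natrX ler_nat; case: (k) => // n; rewrite expnS expn1 leq_pmulr.
Qed.

Lemma enorm_eq0 v : N v = 0 -> v = 0.
Proof.
move=> v0; apply/rowP => i; rewrite mxE; apply: cn_eq0; apply/eqP.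
by rewrite eq_le cn_ge0 andbT -v0 cn_le_enorm.
Qed.

Lemma enorm_gt0 v : v != 0 -> 0 < N v.
Proof.
by move=> v0; rewrite lt_neqAle enorm_ge0 andbT eq_sym; apply: contra v0 => /eqP/enorm_eq0 ->.
Qed.

Lemma enormZ c v : N (c *: v) = cn c * N v.
Proof.
apply/eqP; rewrite -(@eqrXn2 _ 2) ?mulr_ge0 ?cn_ge0// exprMn !sqr_enorm mulr_sumr.
by apply/eqP; apply: eq_bigr => i _; rewrite mxE cnM exprMn.
Qed.

Lemma enormN v : N (- v) = N v.
Proof. by rewrite -scaleN1r enormZ cnN cn1 mul1r. Qed.

Lemma enormBC u v : N (u - v) = N (v - u).
Proof. by rewrite -enormN opprB. Qed.

Lemma cauchy_schwarz u v : \sum_(i < k) cn (u ord0 i) * cn (v ord0 i) <= N u * N v.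
Proof.
have [->|u0] := eqVneq u 0.
  by rewrite big1 ?mulr_ge0// => i _; rewrite mxE cn0 mul0r.
have [->|v0] := eqVneq v 0.
  by rewrite big1 ?mulr_ge0// => i _; rewrite mxE cn0 mulr0.
have A0 := enorm_gt0 u0; have B0 := enorm_gt0 v0.
have : 0 <= \sum_(i < k) (N v * cn (u ord0 i) - N u * cn (v ord0 i)) ^+ 2.
  by apply: sumr_ge0 => i _; rewrite sqr_ge0.
have -> : \sum_(i < k) (N v * cn (u ord0 i) - N u * cn (v ord0 i)) ^+ 2 =
  N v ^+ 2 * N u ^+ 2 + N u ^+ 2 * N v ^+ 2 -
  2 * (N u * N v) * \sum_(i < k) cn (u ord0 i) * cn (v ord0 i).
  rewrite [in N u ^+ 2 * _](sqr_enorm v) [in N v ^+ 2 * _](sqr_enorm u) !mulr_sumr.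
  rewrite -big_split -sumrB; apply: eq_bigr => i _ /=; ring.
have AB : 0 < N u * N v by exact: mulr_gt0.
move=> H; rewrite -(ler_pM2l AB); lra.
Qed.

Lemma enormD u v : N (u + v) <= N u + N v.
Proof.
rewrite -(@ler_pXn2r _ 2) ?nnegrE ?addr_ge0// sqr_enorm sqrrD !sqr_enorm.
have := cauchy_schwarz u v; rewrite -mulr_natl => H.
apply: (@le_trans _ _ (\sum_(i < k) (cn (u ord0 i) + cn (v ord0 i)) ^+ 2)).
  by apply: ler_sum => i _; rewrite ler_pXn2r ?nnegrE ?addr_ge0 ?cn_ge0// mxE cnD.
have -> : \sum_(i < k) (cn (u ord0 i) + cn (v ord0 i)) ^+ 2 =
  \sum_(i < k) cn (u ord0 i) ^+ 2 + 2 * (\sum_(i < k) cn (u ord0 i) * cn (v ord0 i)) +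
  \sum_(i < k) cn (v ord0 i) ^+ 2.
  by rewrite mulr_sumr -!big_split; apply: eq_bigr => i _ /=; ring.
lra.
Qed.

Lemma enormB u v : N (u - v) <= N u + N v.
Proof. by rewrite -(enormN v) enormD. Qed.

Lemma enorm_tri u v w : N (u - w) <= N (u - v) + N (v - w).
Proof. by apply: le_trans (enormD _ _); rewrite addrA subrK. Qed.

Lemma le_mx_norm v i : (cn (v ord0 i))%:C <= `|v|.
Proof.
rewrite -[X in X <= _]/(`|v ord0 i|) [leRHS]mx_normE -[leLHS]nngE num_le.
exact: (le_bigmax _ _ (ord0, i)).
Qed.

Lemma mx_norm_le v : `|v| <= (N v)%:C.
Proof.
have [->|v0] := eqVneq `|v| 0; first by rewrite ler0c.
have [[i j] /= E] := mx_norm_neq0 v0.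
by rewrite [leLHS]E ord1 lecR cn_le_enorm.
Qed.

Lemma gt0_complex c : 0 < c -> c = (re c)%:C.
Proof. by case: c => a b; rewrite ltcE/= => /andP[/eqP-> _]. Qed.

Lemma gt0_complex_re c : 0 < c -> 0 < re c.
Proof. by rewrite ltcE/= => /andP[_]. Qed.

(** The topology is that of the sup norm, whose values are in [Cplx R]. *)
Lemma nbhs_enorm (a : V) (P : set V) :
  nbhs a P <-> exists2 d, 0 < d & forall z, N (z - a) < d -> P z.
Proof.
split.
  move=> /nbhs_ballP[e /= e0 He]; exists (re e); first exact: gt0_complex_re.
  move=> z za; apply: He; split => // i j; rewrite !ord1 -ball_normE/= (gt0_complex e0).
  rewrite ltcR; apply: le_lt_trans za; rewrite enormBC.
  by apply: le_trans (cn_le_enorm _ j); rewrite !mxE.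
move=> [d d0 Hd]; have k0 : 0 < k%:R + 1 :> R by rewrite ltr_wpDl.
have d1 : 0 < d / (k%:R + 1) by exact: divr_gt0.
apply/nbhs_ballP; exists (d / (k%:R + 1))%:C => /=; first by rewrite ltcR.
move=> z [_ za]; apply: Hd; rewrite enormBC.
apply: (@le_lt_trans _ _ (k%:R * (d / (k%:R + 1)))).
  apply: enorm_le_coord; first exact: ltW.
  by move=> i; have := za ord0 i; rewrite -ball_normE/= ltcR !mxE => /ltW.
by rewrite mulrCA gtr_pMr// ltr_pdivrMr// mul1r ltrDl.
Qed.

(** Fréchet differentiability, expressed with the real-valued Euclidean norm. *)
Definition vder (f : V -> V) (a : V) (L : V -> V) := forall e, 0 < e ->
  exists2 d, 0 < d & forall z, N (z - a) < d -> N (f z - f a - L (z - a)) <= e * N (z - a).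

Lemma enorm_le_mx_norm v c : `|v| <= c -> (N v)%:C <= k%:R * c.
Proof.
move=> vc; have c0 : 0 <= c by exact: le_trans vc.
have cE : c = (re c)%:C by move: c0; case: (c) => a b; rewrite lecE/= => /andP[/eqP-> _].
rewrite cE -(rmorph_nat (real_complex R)) -rmorphM lecR.
apply: enorm_le_coord; first by rewrite -ler0c -cE.
by move=> i; rewrite -lecR -cE; exact: le_trans (le_mx_norm _ _) vc.
Qed.

Lemma linear_enorm_bounded (L : {linear V -> V}) : exists2 K, 0 < K & forall v, N (L v) <= K * N v.
Proof.
exists (1 + \sum_(i < k) N (L (delta_mx ord0 i))).
  by rewrite ltr_wpDr// sumr_ge0.
move=> v; rewrite {1}(row_sum_delta v) linear_sum.
apply: (@le_trans _ _ (\sum_(i < k) N (L (v ord0 i *: delta_mx ord0 i)))).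
  by elim/big_ind2: _ => [|a b c d h1 h2|//]; [rewrite enorm0|exact: le_trans (enormD _ _) (lerD h1 h2)].
rewrite mulrDl mul1r mulr_suml; apply: ler_wpDl => //; apply: ler_sum => i _.
by rewrite linearZ enormZ mulrC ler_wpM2l// cn_le_enorm.
Qed.

Lemma differentiable_vder (f : V -> V) a : differentiable f a -> vder f a ('d f a).
Proof.
move=> /diff_locallyP[_ /eqaddoP H] e e0.
have k1 : 0 < k%:R + 1 :> R by rewrite ltr_wpDl.
have e1 : 0 < e / (k%:R + 1) by exact: divr_gt0.
have /(H _)/nbhs_enorm[d d0 Hd] : 0 < (e / (k%:R + 1))%:C :> C by rewrite ltcR.
exists d => // z za; have := Hd (z - a); rewrite subr0 => /(_ za) /=.
rewrite !fctE/= subrK => /enorm_le_mx_norm; rewrite opprD addrA => h1.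
have h2 : k%:R * ((e / (k%:R + 1))%:C * `|z - a|) <= (k%:R * (e / (k%:R + 1)) * N (z - a))%:C :> C.
  rewrite -(rmorph_nat (real_complex R)) mulrA -rmorphM [leRHS]rmorphM.
  by rewrite ler_wpM2l ?mx_norm_le// ler0c mulr_ge0 ?ler0n// ltW.
have := le_trans h1 h2; rewrite lecR => /le_trans; apply.
rewrite ler_wpM2r// mulrCA ger_pMr// ler_pdivrMr//; lra.
Qed.

Lemma vder_differentiable (f : V -> V) a (L : {linear V -> V}) :
  vder f a L -> differentiable f a.
Proof.
move=> H.
have cL : continuous L.
  have [K K0 HK] := linear_enorm_bounded L.
  move=> x P /nbhs_enorm[d d0 Hd]; apply/nbhs_enorm; exists (d / K); first exact: divr_gt0.
  move=> z; rewrite ltr_pdivlMr// => zx; apply: Hd; rewrite -linearB.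
  by apply: le_lt_trans (HK _) _; rewrite mulrC.
have E : f \o shift a = cst (f a) + L +o_ (0 : V) id.
  apply/eqaddoP => c c0; rewrite (gt0_complex c0).
  move: (gt0_complex_re c0); move: (re c) => {c c0} e e0.
  have k1 : 0 < k%:R + 1 :> R by rewrite ltr_wpDl.
  have [d d0 Hd] := H _ (divr_gt0 e0 k1).
  apply/nbhs_enorm; exists d => // h; rewrite subr0 => hd.
  have := Hd (h + a); rewrite addrK => /(_ hd) hh.
  rewrite !fctE/= opprD addrA; apply: le_trans (mx_norm_le _) _.
  apply: (@le_trans _ _ (e / (k%:R + 1) * N h)%:C); first by rewrite lecR.
  rewrite rmorphM; apply: le_trans (ler_wpM2l _ (enorm_le_mx_norm (lexx `|h|))) _.
    by rewrite ler0c divr_ge0// ltW.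
  rewrite mulrA ler_wpM2r// -(rmorph_nat (real_complex R)) -rmorphM lecR.
  by rewrite mulrAC ler_pdivrMr// ler_pM2l// lerDl.
by apply/diff_locallyP; rewrite (diff_unique cL E).
Qed.

End Enorm.

(** * Limits of bounded sequences of holomorphic maps *)

Lemma real_cauchy_limit (R : realType) (u : nat -> R) :
  (forall e, 0 < e -> exists n, forall m p, (n <= m)%N -> (n <= p)%N -> `|u m - u p| <= e) ->
  exists l, forall e, 0 < e -> exists n, forall m, (n <= m)%N -> `|u m - l| <= e.
Proof.
move=> H.
have /cvg_ex[l ul] : cvg (u @ \oo).
  apply: cauchy_cvg; apply: cauchy_exP => e e0.
  have e2 : 0 < e / 2 by lra.
  have [n Hn] := H _ e2; exists (u n); exists n => // m /= nm.
  rewrite -ball_normE/=; apply: le_lt_trans (Hn n m (leqnn n) nm) _; lra.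
exists l => e e0; have /cvgrPdist_le/(_ e e0)[n _ Hn] := ul.
by exists n => m nm; rewrite distrC; exact: Hn.
Qed.

Section HolomorphicLimits.
Variables (R : realType) (k : nat).
Notation C := (Cplx R).
Notation V := 'rV[Cplx R]_k.
Notation N := (@enorm R k).
Implicit Types (u v z w a h : V) (c : C) (e d rho M : R) (f : V -> V).

Definition vlim (u : nat -> V) (l : V) := forall e, 0 < e -> exists n,
  forall m, (n <= m)%N -> N (u m - l) <= e.

Lemma vlim_cvg (u : nat -> V) l : u j @[j --> \oo] --> l <-> vlim u l.
Proof.
split.
  move=> ul e e0; have : nbhs l [set z | N (z - l) <= e].
    by apply/nbhs_enorm; exists e => // z /ltW.
  by move=> /ul[n _ Hn]; exists n => m nm; exact: Hn.
move=> ul P /nbhs_enorm[d d0 Hd]; have d2 : 0 < d / 2 by lra.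
have [n Hn] := ul _ d2; exists n => // m /= nm; apply: Hd.
by apply: le_lt_trans (Hn m nm) _; lra.
Qed.

Lemma le_eps_enorm0 v : (forall e, 0 < e -> N v <= e) -> v = 0.
Proof.
move=> H; apply/enorm_eq0/eqP; rewrite eq_le enorm_ge0 andbT.
by apply/ler_addgt0Pr => e e0; rewrite add0r H.
Qed.

Lemma vlim_uniq (u : nat -> V) l l' : vlim u l -> vlim u l' -> l = l'.
Proof.
move=> H H'; apply/eqP; rewrite -subr_eq0; apply/eqP/le_eps_enorm0 => e e0.
have e2 : 0 < e / 2 by lra.
have [n Hn] := H _ e2; have [m Hm] := H' _ e2.
have := enorm_tri l (u (maxn n m)) l'; rewrite (enormBC l (u _)).
have := Hn (maxn n m) (leq_maxl _ _); have := Hm (maxn n m) (leq_maxr _ _); lra.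
Qed.

Lemma vlim_cauchy (u : nat -> V) :
  (forall e, 0 < e -> exists n, forall m p, (n <= m)%N -> (n <= p)%N -> N (u m - u p) <= e) ->
  exists l, vlim u l.
Proof.
move=> H.
have coord (i : 'I_k) : exists c : C, forall e, 0 < e -> exists n, forall m, (n <= m)%N ->
    cn (u m ord0 i - c) <= e.
  have [x Hx] : exists x, forall e, 0 < e -> exists n, forall m, (n <= m)%N -> `|re (u m ord0 i) - x| <= e.
    apply: real_cauchy_limit => e e0; have [n Hn] := H e e0; exists n => m p nm np.
    apply: le_trans (Hn m p nm np); apply: le_trans (cn_le_enorm _ i).
    by rewrite !mxE -reN -reD Re_le_cn.
  have [y Hy] : exists y, forall e, 0 < e -> exists n, forall m, (n <= m)%N -> `|im (u m ord0 i) - y| <= e.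
    apply: real_cauchy_limit => e e0; have [n Hn] := H e e0; exists n => m p nm np.
    apply: le_trans (Hn m p nm np); apply: le_trans (cn_le_enorm _ i).
    by rewrite !mxE -imN -imD Im_le_cn.
  exists (x +i* y) => e e0; have e2 : 0 < e / 2 by lra.
  have [n Hn] := Hx _ e2; have [m Hm] := Hy _ e2; exists (maxn n m) => p.
  rewrite geq_max => /andP[/Hn h1 /Hm h2]; apply: le_trans (cn_le_ReIm _) _.
  by rewrite reD imD reN imN/= [leRHS]splitr; exact: lerD.
have [l Hl] := choice coord.
exists (\row_i l i) => e e0; have k0 : 0 < k%:R + 1 :> R by rewrite ltr_wpDl.
have [n Hn] := choice (fun i => Hl i _ (divr_gt0 e0 k0)).
exists (\max_i n i) => m nm.
apply: (@le_trans _ _ (k%:R * (e / (k%:R + 1)))).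
  apply: enorm_le_coord; first by rewrite divr_ge0// ltW.
  by move=> i; rewrite !mxE; apply: Hn; apply: leq_trans nm; exact: leq_bigmax.
by rewrite mulrCA ger_pMr// ler_pdivrMr// mul1r lerDl.
Qed.

Lemma vlim_geometric (u : nat -> V) (K q : R) : 0 <= K -> 0 <= q -> q < 1 ->
  (forall n, N (u n.+1 - u n) <= K * q ^+ n) ->
  exists2 l, vlim u l & forall n, N (l - u n) <= K * q ^+ n / (1 - q).
Proof.
move=> K0 q0 q1 H; have q1' : 0 < 1 - q by lra.
have step n p : N (u (p + n)%N - u n) <= K * q ^+ n / (1 - q) - K * q ^+ (p + n) / (1 - q).
  elim: p => [|p IH]; first by rewrite add0n !subrr enorm0.
  apply: le_trans (enorm_tri _ (u (p + n)%N) _) _.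
  apply: le_trans (lerD (H _) IH) _; rewrite addSn exprS le_eqVlt; apply/orP; left.
  by apply/eqP; field; exact: lt0r_neq0.
have tail n m : (n <= m)%N -> N (u m - u n) <= K * q ^+ n / (1 - q).
  move=> /subnK <-; apply: le_trans (step _ _) _; rewrite lerBlDr lerDl.
  by rewrite divr_ge0 ?mulr_ge0 ?exprn_ge0// ltW.
have small e : 0 < e -> exists n, K * q ^+ n / (1 - q) <= e.
  move=> e0; have K1 : 0 < K + 1 by lra.
  have e1 : 0 < e * (1 - q) / (K + 1) by rewrite divr_gt0 ?mulr_gt0.
  have : q ^+ n @[n --> \oo] --> 0 by apply: cvg_expr; rewrite ger0_norm.
  move=> /cvgrPdist_le/(_ _ e1)[n _ Hn]; exists n.
  have := Hn n (leqnn n); rewrite sub0r normrN ger0_norm ?exprn_ge0// ler_pdivlMr// => h.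
  rewrite ler_pdivrMr//; apply: le_trans h; rewrite mulrC ler_wpM2l ?exprn_ge0//; lra.
have [l Hl] : exists l, vlim u l.
  apply: vlim_cauchy => e e0; have e2 : 0 < e / 2 by lra.
  have [n Hn] := small _ e2; exists n => m p nm np.
  apply: le_trans (enorm_tri _ (u n) _) _; rewrite (enormBC (u n) (u p)).
  have := tail n m nm; have := tail n p np; lra.
exists l => // n; apply/ler_addgt0Pr => e e0; have [m Hm] := Hl e e0.
apply: le_trans (enorm_tri _ (u (maxn n m)) _) _; rewrite addrC.
by apply: lerD; [exact: tail _ _ (leq_maxl _ _)|rewrite enormBC; exact: Hm _ (leq_maxr _ _)].
Qed.

Definition vdiff f a := exists L : {linear V -> V}, vder f a L.

Definition vdiff_bounded f a rho M := forall z, N (z - a) < rho -> vdiff f z /\ N (f z) <= M.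

Lemma vdiff_bounded_ge0 f a rho M : 0 < rho -> vdiff_bounded f a rho M -> 0 <= M.
Proof.
move=> rho0 H; have [_] : vdiff f a /\ N (f a) <= M by apply: H; rewrite subrr enorm0.
exact: le_trans (enorm_ge0 _).
Qed.

(** Restriction to a complex line through [a], one coordinate at a time. *)
Lemma slice_cder f a v (x : C) (L : {linear V -> V}) i :
  vder f (a + x *: v) L -> cder (fun y => f (a + y *: v) ord0 i) x (L v ord0 i).
Proof.
move=> H e e0; have K0 : 0 < 1 + N v by have := enorm_ge0 v; lra.
have [d d0 Hd] := H _ (divr_gt0 e0 K0); exists (d / (1 + N v)); first exact: divr_gt0.
move=> y; rewrite ltr_pdivlMr// => yd.
have E : a + y *: v - (a + x *: v) = (y - x) *: v.
  by rewrite scalerBl opprD addrACA subrr add0r.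
have v0 := enorm_ge0 v; have y0 := cn_ge0 (y - x).
have yd' : cn (y - x) * N v < d by nra.
have := Hd (a + y *: v); rewrite E enormZ => /(_ yd') h.
have := cn_le_enorm (f (a + y *: v) - f (a + x *: v) - L ((y - x) *: v)) i.
rewrite linearZ !mxE (mulrC (L v ord0 i)) => /le_trans; apply.
rewrite linearZ in h; apply: le_trans h _.
rewrite mulrCA mulrC ler_wpM2r// mulrAC -mulrA ger_pMr// ler_pdivrMr//; lra.
Qed.

Lemma slice_bounded f a rho M h : h != 0 -> vdiff_bounded f a rho M -> forall i,
  cdiff_on (fun y => f (a + y *: h) ord0 i) (rho / N h) /\
  forall y, cn y < rho / N h -> cn (f (a + y *: h) ord0 i) <= M.
Proof.
move=> h0 H i; have n0 := enorm_gt0 h0.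
have inb y : cn y < rho / N h -> N (a + y *: h - a) < rho.
  by rewrite ltr_pdivlMr// addrC addKr enormZ.
split=> y /inb/H[[L dL] fM]; first by eexists; exact: slice_cder dL.
exact: le_trans (cn_le_enorm _ i) fM.
Qed.

Lemma holo_lipschitz f a rho M h : 0 < rho -> vdiff_bounded f a rho M -> N h < rho / 2 ->
  N (f (a + h) - f a) <= k%:R * (24 * M / rho * N h).
Proof.
move=> rho0 H hr.
have M0 := vdiff_bounded_ge0 rho0 H.
have [->|h0] := eqVneq h 0; first by rewrite addr0 subrr enorm0 !mulr0.
have n0 := enorm_gt0 h0; apply: enorm_le_coord => [|i].
  by rewrite mulr_ge0// divr_ge0 ?mulr_ge0// ltW.
have [D B] := slice_bounded h0 H i.
have r0 : 0 < rho / N h by exact: divr_gt0.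
have := bounded_lipschitz (z := 1) (w := 0) r0 D B.
rewrite scale1r scale0r addr0 cn1 cn0 subr0 cn1 mulr1 !mxE.
rewrite (_ : 24 * M / (rho / N h) = 24 * M / rho * N h); last first.
  by field; rewrite !gt_eqF.
apply; last by lra.
by rewrite mulrAC ltr_pdivlMr// mul1r.
Qed.

Lemma taylor_bound_ge0 rho M : 0 <= M -> 0 <= 1152 * M / rho ^+ 2.
Proof.
move=> M0; apply: mulr_ge0; last by rewrite invr_ge0 sqr_ge0.
by apply: mulr_ge0 M0; exact: ler0n.
Qed.

Lemma holo_taylor f a rho M h (L : {linear V -> V}) : 0 < rho -> vdiff_bounded f a rho M ->
  vder f a L -> N h < rho / 4 ->
  N (f (a + h) - f a - L h) <= k%:R * (1152 * M / rho ^+ 2 * N h ^+ 2).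
Proof.
move=> rho0 H dL hr.
have M0 := vdiff_bounded_ge0 rho0 H.
have [->|h0] := eqVneq h 0.
  by rewrite addr0 linear0 !subrr enorm0 expr0n !mulr0.
have n0 := enorm_gt0 h0; apply: enorm_le_coord => [|i].
  by apply: mulr_ge0 (sqr_ge0 _); exact: taylor_bound_ge0.
have [D B] := slice_bounded h0 H i.
have r0 : 0 < rho / N h by exact: divr_gt0.
have D0 : cder (fun y => f (a + y *: h) ord0 i) 0 (L h ord0 i).
  by apply: slice_cder; rewrite scale0r addr0.
have := bounded_taylor (h := 1) r0 D B D0.
rewrite scale1r scale0r addr0 cn1 expr1n !mulr1 !mxE.
rewrite (_ : 1152 * M / (rho / N h) ^+ 2 = 1152 * M / rho ^+ 2 * N h ^+ 2); last first.
  by field; rewrite !gt_eqF.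
by apply; rewrite mulrAC ltr_pdivlMr// mul1r.
Qed.

Definition mk_linear (L : V -> V) (H : linear L) : {linear V -> V} :=
  HB.pack L (GRing.isLinear.Build _ _ _ _ L H).

Lemma vlimD (u u' : nat -> V) l l' : vlim u l -> vlim u' l' -> vlim (fun j => u j + u' j) (l + l').
Proof.
move=> H H' e e0; have e2 : 0 < e / 2 by lra.
have [n Hn] := H _ e2; have [m Hm] := H' _ e2; exists (maxn n m) => p.
rewrite geq_max => /andP[/Hn h1 /Hm h2]; rewrite opprD addrACA.
by apply: le_trans (enormD _ _) _; lra.
Qed.

Lemma vlimZ (u : nat -> V) l c : vlim u l -> vlim (fun j => c *: u j) (c *: l).
Proof.
move=> H e e0; have c0 := cn_ge0 c; have c1 : 0 < 1 + cn c by lra.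
have [n Hn] := H _ (divr_gt0 e0 c1); exists n => m /Hn h.
rewrite -scalerBr enormZ; apply: le_trans (ler_wpM2l c0 h) _.
by rewrite mulrCA ger_pMr// ler_pdivrMr//; lra.
Qed.

Lemma vlim_cst l : vlim (fun=> l) l.
Proof. by move=> e e0; exists 0%N => m _; rewrite subrr enorm0 ltW. Qed.

Lemma vlimB (u u' : nat -> V) l l' : vlim u l -> vlim u' l' -> vlim (fun j => u j - u' j) (l - l').
Proof.
move=> H /(vlimZ (-1)) H'; rewrite -scaleN1r.
rewrite (_ : (fun j => _) = (fun j => u j + -1 *: u' j)); first exact: vlimD.
by apply/funext => j; rewrite scaleN1r.
Qed.

Lemma vlim_le (u : nat -> V) l (B : R) : vlim u l -> (forall j, N (u j) <= B) -> N l <= B.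
Proof.
move=> H uB; apply/ler_addgt0Pr => e e0; have [n /(_ n (leqnn n)) Hn] := H e e0.
have := enormB (u n) (u n - l); rewrite subKr; have := uB n; lra.
Qed.

(** Pointwise convergence suffices because the second order estimate is uniform:
it bounds the derivatives L_j h, up to O(t), by difference quotients with step t,
which converge; so L_j h is a Cauchy sequence. The second order estimate then
passes to the limit and shows that the limit of the L_j is the derivative. *)
Lemma holo_limit (f : nat -> V -> V) g a rho M : 0 < rho ->
  (forall j, vdiff_bounded (f j) a rho M) ->
  (forall z, N (z - a) < rho -> vlim (fun j => f j z) (g z)) -> vdiff g a.
Proof.
move=> rho0 H fg.
have M0 := vdiff_bounded_ge0 rho0 (H 0%N).
have aa : N (a - a) < rho by rewrite subrr enorm0.
have [L HL] := choice (fun j => (H j a aa).1).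
pose K := k%:R * (1152 * M / rho ^+ 2).
have K0 : 0 <= K by apply: mulr_ge0 (ler0n _ _) (taylor_bound_ge0 _ M0).
have T j h : N h < rho / 4 -> N (f j (a + h) - f j a - L j h) <= K * N h ^+ 2.
  by move=> hr; have := holo_taylor rho0 (H j) (HL j) hr; rewrite /K mulrA.
have near h : N h < rho / 4 -> vlim (fun j => f j (a + h) - f j a) (g (a + h) - g a).
  move=> hr; apply: vlimB; apply: fg => //.
  by rewrite addrC addKr; lra.
have LC h : exists l, vlim (fun j => L j h) l.
  apply: vlim_cauchy => e e0; have h0 := enorm_ge0 h.
  (* t makes the second order error of the difference quotient at most e / 4. *)
  pose t := Num.min (rho / (8 * (1 + N h))) (e / (4 * (K * N h ^+ 2 + 1))).
  have kh : 0 <= K * N h ^+ 2 by rewrite mulr_ge0 ?sqr_ge0.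
  have t0 : 0 < t by rewrite lt_min !divr_gt0//; lra.
  have tr : t * N h < rho / 4.
    have : t <= rho / (8 * (1 + N h)) by rewrite ge_min lexx.
    rewrite ler_pdivlMr; last by lra.
    nra.
  have te : t * (K * N h ^+ 2) <= e / 4.
    have : t <= e / (4 * (K * N h ^+ 2 + 1)) by rewrite ge_min lexx orbT.
    rewrite ler_pdivlMr; last by lra.
    nra.
  have Nt : N (t%:C *: h) = t * N h by rewrite enormZ cn_real ger0_norm// ltW.
  have tr' : N (t%:C *: h) < rho / 4 by rewrite Nt.
  have te0 : 0 < t * e / 4 by rewrite divr_gt0// mulr_gt0.
  have [n Hn] := near _ tr' _ te0; exists n => m p nm np.
  rewrite -(ler_pM2l t0) -[X in X * N _](ger0_norm (ltW t0)) -cn_real -enormZ.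
  rewrite scalerBr -!linearZ; set th := t%:C *: h in Hn tr' Nt *.
  have := Hn m nm; have := Hn p np; have := T m th tr'; have := T p th tr'.
  set A := f m _ - _; set B := f p _ - _; set G := g _ - _.
  move=> h1 h2 h3 h4.
  have -> : L m th - L p th = (B - L p th) - (A - L m th) + (A - G) - (B - G).
    move: (L m th) (L p th) => a1 a2; clearbody A B G; clear.
    by apply/rowP => i; rewrite !mxE; ring.
  apply: le_trans (enormB _ _) _; apply: le_trans (lerD (enormD _ _) (lexx _)) _.
  apply: le_trans (lerD (lerD (enormB _ _) (lexx _)) (lexx _)) _.
  have E2 : K * N th ^+ 2 = t * (t * (K * N h ^+ 2)) by rewrite Nt; ring.
  have : t * (t * (K * N h ^+ 2)) <= t * (e / 4) by rewrite ler_pM2l.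
  rewrite -E2; lra.
have [D HD] := choice LC.
have linD : linear D.
  move=> c u v; apply: (vlim_uniq (HD _)).
  rewrite (_ : (fun j => L j (c *: u + v)) = (fun j => c *: L j u + L j v)); last first.
    by apply/funext => j; rewrite linearP.
  by apply: vlimD => //; exact: vlimZ.
exists (mk_linear linD) => e e0.
exists (Num.min (rho / 4) (e / (K + 1))); first by rewrite lt_min !divr_gt0//; lra.
move=> z; rewrite lt_min => /andP[zr ze].
have -> : g z - g a - D (z - a) = g (a + (z - a)) - g a - D (z - a) by rewrite subrKC.
have : N (g (a + (z - a)) - g a - D (z - a)) <= K * N (z - a) ^+ 2.
  apply: (vlim_le (u := fun j => f j (a + (z - a)) - f j a - L j (z - a))).
    by apply: vlimB (HD _); exact: near.
  by move=> j; exact: T.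
move/le_trans; apply; rewrite expr2 mulrA ler_wpM2r//.
move: ze; rewrite ltr_pdivlMr; last by lra.
have := enorm_ge0 (z - a); nra.
Qed.

End HolomorphicLimits.

(** * Rescaled iterates near a fixed point *)

Section LocalConjugacy.
Variables (R : realType) (k : nat).
Notation C := (Cplx R).
Notation V := 'rV[Cplx R]_k.
Notation N := (@enorm R k).
Implicit Types (u v w x y z h : V) (c : C) (s r delta eta : R) (f : V -> V).
Implicit Types (F G : nat -> V -> V) (A B : nat -> {linear V -> V}).

Lemma vdiffP f z : vdiff f z <-> differentiable f z.
Proof.
split=> [[L]|df]; first exact: vder_differentiable.
by exists ('d f z); exact: differentiable_vder.
Qed.

Lemma vder_linear (L : {linear V -> V}) z : vder L z L.
Proof.
by move=> e e0; exists 1 => // w _; rewrite linearB subrr enorm0 mulr_ge0// ltW.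
Qed.

Lemma differentiable_idV z : differentiable (id : V -> V) z.
Proof. by apply/vdiffP; exists idfun; exact: (vder_linear idfun). Qed.

Lemma vdiff_sub_id f z : vdiff f z -> vdiff (fun w => f w - w) z.
Proof.
move=> [L H]; exists (L \- idfun) => e /H[d d0 Hd]; exists d => // w /Hd.
congr (enorm _ <= _); rewrite /=; move: (L (w - z)) (f w) (f z) => a b c.
by apply/rowP => i; rewrite !mxE; ring.
Qed.

(** Indices start at 0: [iterates F j] is F_(j-1) o ... o F_0. *)
Fixpoint iterates F j z := if j is j'.+1 then F j' (iterates F j' z) else z.

(** A(j)^-1, if [B j] is the inverse of A_j. *)
Fixpoint pullback B j v : V := if j is j'.+1 then pullback B j' (B j' v) else v.

Definition rescaled F B j z := pullback B j (iterates F j z).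

(** [A j] is the derivative of [F j] at 0, and [B j] its inverse. *)
Record contracting s r delta F A B : Prop := Contracting {
  ctr_diff : forall j z, N z < delta -> differentiable (F j) z;
  ctr_bound : forall j z, N z < delta -> s * N z <= N (F j z) <= r * N z;
  ctr_der : forall j, vder (F j) 0 (A j);
  ctr_AB : forall j v, A j (B j v) = v;
  ctr_BA : forall j v, B j (A j v) = v }.

Lemma pullback_linear B j : linear (pullback B j).
Proof. by elim: j => [//|j IH] c u v /=; rewrite linearP IH. Qed.

Lemma pullbackB B j u v : pullback B j (u - v) = pullback B j u - pullback B j v.
Proof. by elim: j u v => [//|j IH] u v /=; rewrite linearB IH. Qed.

Lemma pullback0 B j : pullback B j 0 = 0.
Proof. by elim: j => //= j IH; rewrite linear0. Qed.

Lemma pullback_diff B j z : differentiable (pullback B j) z.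
Proof.
by apply/vdiffP; exists (mk_linear (pullback_linear B j)); exact: (vder_linear (mk_linear (pullback_linear B j))).
Qed.

Lemma iterates_shift F n j z : iterates F (n + j) z = iterates (fun i => F (n + i)%N) j (iterates F n z).
Proof. by elim: j => [|j IH]; rewrite ?addn0// addnS /= IH. Qed.

Lemma pullback_shift B n j v :
  pullback B (n + j) v = pullback B n (pullback (fun i => B (n + i)%N) j v).
Proof. by elim: j v => [|j IH] v; rewrite ?addn0// addnS /= IH. Qed.

Lemma contracting_shift s r delta F A B n : contracting s r delta F A B ->
  contracting s r delta (fun j => F (n + j)%N) (fun j => A (n + j)%N) (fun j => B (n + j)%N).
Proof. by case=> *; split=> // *; auto. Qed.

(** The fixed point of the contraction z |-> w - (Psi z - z), as the limit of its
iterates from 0; they stay in the ball of radius 2 |w|. *)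
Lemma banach_perturbation (Psi : V -> V) eta w : Psi 0 = 0 ->
  (forall x y, N x < eta -> N y < eta -> N (Psi x - Psi y - (x - y)) <= 2^-1 * N (x - y)) ->
  N w < eta / 2 -> exists2 z, N z < eta & Psi z = w.
Proof.
move=> P0 H wr; have eta0 : 0 < eta by have := enorm_ge0 w; lra.
pose u := fix u n := if n is m.+1 then w - (Psi (u m) - u m) else 0.
have uS n : u n.+1 = w - (Psi (u n) - u n) by [].
have small x : N x < eta -> N (Psi x - x) <= 2^-1 * N x.
  by move=> xr; have := H x 0 xr; rewrite P0 enorm0 !subr0; exact.
have ur n : N (u n) <= 2 * N w.
  elim: n => [|n IH] /=; first by rewrite enorm0 mulr_ge0.
  apply: le_trans (enormB _ _) _.
  have := small (u n); have := enorm_ge0 w; lra.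
have ur' n : N (u n) < eta by apply: le_lt_trans (ur n) _; lra.
have step n : N (u n.+1 - u n) <= N w * 2^-1 ^+ n.
  elim: n => [|n IH]; first by rewrite /= P0 !subrr !subr0 expr0 mulr1.
  rewrite (uS n.+1) [X in _ - X](uS n).
  rewrite (_ : _ - _ = - (Psi (u n.+1) - Psi (u n) - (u n.+1 - u n))); last first.
    move: (Psi (u n.+1)) (Psi (u n)) (u n.+1) (u n) => a b c d.
    by apply/rowP => i; rewrite !mxE; ring.
  rewrite enormN; apply: le_trans (H _ _ (ur' _) (ur' _)) _.
  by rewrite exprS mulrCA ler_pM2l// invr_gt0.
have q0 : 0 <= 2^-1 :> R by rewrite invr_ge0.
have q1 : 2^-1 < 1 :> R by rewrite invf_lt1// ltr1n.
have [z zl _] := vlim_geometric (enorm_ge0 w) q0 q1 step.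
have zr : N z < eta.
  by apply: (@le_lt_trans _ _ (2 * N w)); [exact: vlim_le zl ur|lra].
exists z => //; apply/eqP; rewrite -subr_eq0; apply/eqP/le_eps_enorm0 => e e0.
have e4 : 0 < e / 4 by lra.
have [n Hn] := zl _ e4.
have h1 := Hn n (leqnn n); have h2 := Hn n.+1 (leqnSn n).
have h3 := H z (u n) zr (ur' n); rewrite (enormBC z) in h3.
rewrite (_ : Psi z - w = (Psi z - Psi (u n) - (z - u n)) - (u n.+1 - z)); last first.
  rewrite uS; move: (Psi z) (Psi (u n)) (u n) => a b c.
  by apply/rowP => i; rewrite !mxE; ring.
by apply: le_trans (enormB _ _) _; lra.
Qed.

(** Surjectivity is the previous lemma on a large ball, so no basis is chosen. *)
Lemma linear_near_id_inverse (D : {linear V -> V}) : (forall v, N (D v - v) <= 2^-1 * N v) ->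
  exists2 E : {linear V -> V}, forall v, D (E v) = v & forall v, N (E v) <= 2 * N v.
Proof.
move=> H.
have surj w : exists z, D z = w.
  have [||z _ <-] := @banach_perturbation D (2 * N w + 1) w (linear0 _); last by exists z.
    by move=> x y _ _; rewrite -linearB; exact: H.
  by lra.
have lower v : N v <= 2 * N (D v).
  by have := enormB (D v) (D v - v); rewrite subKr; have := H v; lra.
have [E HE] := choice surj.
have linE : linear E.
  move=> c u v; apply/eqP; rewrite -subr_eq0; apply/eqP/enorm_eq0/eqP.
  rewrite eq_le enorm_ge0 andbT; apply: le_trans (lower _) _.
  by rewrite linearB linearP !HE subrr enorm0 mulr0.
exists (mk_linear linE) => // v; apply: le_trans (lower _) _.
by rewrite HE.
Qed.

(** The derivative D of Psi is as close to the identity as Psi itself, hence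
invertible; since psi is 2-Lipschitz, the remainder of Psi is also negligible
against increments of its argument w, and D^-1 is the derivative of psi. *)
Lemma perturbation_inverse_diff (Psi psi : V -> V) eta w0 :
  (forall x y, N x < eta -> N y < eta -> N (Psi x - Psi y - (x - y)) <= 2^-1 * N (x - y)) ->
  (forall x, N x < eta -> vdiff Psi x) ->
  (forall w, N w < eta / 2 -> N (psi w) < eta /\ Psi (psi w) = w) ->
  N w0 < eta / 2 -> vdiff psi w0.
Proof.
move=> H dPsi Hpsi w0r; have [z0r Pz0] := Hpsi _ w0r.
set z0 := psi w0 in z0r Pz0.
have [D HD] := dPsi _ z0r.
have Dnear v : N (D v - v) <= 2^-1 * N v.
  have [->|v0] := eqVneq v 0; first by rewrite linear0 subrr enorm0 mulr0.
  have n0 := enorm_gt0 v0.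
  apply/ler_addgt0Pr => e e0; have [d d0 Hd] := HD _ (divr_gt0 e0 n0).
  pose t := Num.min (d / 2) ((eta - N z0) / 2) / N v.
  have m0 : 0 < Num.min (d / 2) ((eta - N z0) / 2) by rewrite lt_min; apply/andP; split; lra.
  have t0 : 0 < t by exact: divr_gt0.
  have Nt : N (t%:C *: v) = Num.min (d / 2) ((eta - N z0) / 2).
    by rewrite enormZ cn_real ger0_norm ?ltW// /t divfK// gt_eqF.
  have td : N (t%:C *: v) < d.
    by rewrite Nt gt_min; apply/orP; left; lra.
  have te : N (z0 + t%:C *: v) < eta.
    apply: le_lt_trans (enormD _ _) _; rewrite Nt.
    have : Num.min (d / 2) ((eta - N z0) / 2) <= (eta - N z0) / 2 by rewrite ge_min lexx orbT.
    lra.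
  have E : z0 + t%:C *: v - z0 = t%:C *: v by rewrite addrC addKr.
  have := H _ _ te z0r; have := Hd (z0 + t%:C *: v); rewrite E => /(_ td).
  set th := t%:C *: v; set P := Psi _ => h1 h2.
  have Nth : N th = t * N v by rewrite /th enormZ cn_real ger0_norm// ltW.
  rewrite -(ler_pM2l t0) -[X in X * N _ <= _](ger0_norm (ltW t0)) -cn_real -enormZ.
  rewrite scalerBr -linearZ -/th.
  rewrite (_ : D th - th = (P - Psi z0 - th) - (P - Psi z0 - D th)); last first.
    by move: (D th) (Psi z0) => a b; apply/rowP => i; rewrite !mxE; ring.
  apply: le_trans (enormB _ _) _; apply: le_trans (lerD h2 h1) _.
  rewrite Nth le_eqVlt; apply/orP; left; apply/eqP; field; exact: lt0r_neq0.
have [E HE1 HE2] := linear_near_id_inverse Dnear.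
have ED v : E (D v) = v.
  have : D (E (D v) - v) = 0 by rewrite linearB HE1 subrr.
  move=> D0; have := Dnear (E (D v) - v); rewrite D0 sub0r enormN => h.
  apply/eqP; rewrite -subr_eq0; apply/eqP/enorm_eq0/eqP.
  by rewrite eq_le enorm_ge0 andbT; lra.
exists E => e e0; have e4 : 0 < e / 4 by lra.
have [d d0 Hd] := HD _ e4.
exists (Num.min (d / 2) (eta / 2 - N w0)); first by rewrite lt_min; apply/andP; split; lra.
move=> w; rewrite lt_min => /andP[wd we].
have wr : N w < eta / 2.
  by have := enormD (w - w0) w0; rewrite subrK; lra.
have [zr Pz] := Hpsi _ wr; set z := psi w in zr Pz *.
have lip : N (z - z0) <= 2 * N (w - w0).
  have := H _ _ zr z0r; rewrite Pz Pz0 => h.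
  by have := enormB (w - w0) (w - w0 - (z - z0)); rewrite subKr; lra.
have := Hd z; rewrite Pz Pz0 => /(_ _) h.
have {}h : N (w - w0 - D (z - z0)) <= e / 4 * N (z - z0) by apply: h; lra.
rewrite (_ : z - z0 - E (w - w0) = - E (w - w0 - D (z - z0))); last first.
  by rewrite [E (_ - D _)]linearB ED opprB.
rewrite enormN; apply: le_trans (HE2 _) _.
nra.
Qed.

(** Apply the bounds for f to t v and let t tend to 0. *)
Lemma derivative_bounds f (L : {linear V -> V}) s r delta v : 0 < delta -> f 0 = 0 -> vder f 0 L ->
  (forall z, N z < delta -> s * N z <= N (f z) <= r * N z) -> s * N v <= N (L v) <= r * N v.
Proof.
move=> dpos f0 dL fb.
have [->|v0] := eqVneq v 0; first by rewrite linear0 enorm0 !mulr0 lexx.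
have n0 := enorm_gt0 v0.
suff H e : 0 < e -> s * N v - e <= N (L v) <= r * N v + e.
  by apply/andP; split; apply/ler_addgt0Pr => e /H/andP[]; rewrite ?lerBlDr.
move=> e0; have [d d0 Hd] := dL _ (divr_gt0 e0 n0).
have m0 : 0 < Num.min (d / 2) (delta / 2) by rewrite lt_min; apply/andP; split; lra.
pose t := Num.min (d / 2) (delta / 2) / N v.
have t0 : 0 < t by exact: divr_gt0.
have Nt : N (t%:C *: v) = Num.min (d / 2) (delta / 2).
  by rewrite enormZ cn_real ger0_norm ?ltW// /t divfK// gt_eqF.
have td : N (t%:C *: v) < d by rewrite Nt gt_min; apply/orP; left; lra.
have te : N (t%:C *: v) < delta by rewrite Nt gt_min; apply/orP; right; lra.
have Nth : N (t%:C *: v) = t * N v by rewrite enormZ cn_real ger0_norm// ltW.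
have := Hd (t%:C *: v); rewrite subr0 f0 subr0 => /(_ td) h1.
have /andP[h2 h3] := fb _ te.
have h4 := enormD (f (t%:C *: v) - L (t%:C *: v)) (L (t%:C *: v)); rewrite subrK in h4.
have h5 := enormB (f (t%:C *: v)) (f (t%:C *: v) - L (t%:C *: v)); rewrite subKr in h5.
have NL : N (L (t%:C *: v)) = t * N (L v) by rewrite linearZ enormZ cn_real ger0_norm// ltW.
have E : e / N v * (t * N v) = t * e by field; exact: lt0r_neq0.
rewrite NL in h4 h5; rewrite Nth E in h1; rewrite Nth in h2 h3.
rewrite -(ler_pM2l t0) -[X in _ && X](ler_pM2l t0) mulrBr mulrDr.
apply/andP; split; lra.
Qed.

Section Estimates.
Variables (s r delta : R) (F : nat -> V -> V) (A B : nat -> {linear V -> V}).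
Hypotheses (s0 : 0 < s) (r0 : 0 < r) (r1 : r < 1) (rs : r ^+ 2 < s) (delta0 : 0 < delta).
Hypothesis ctr : contracting s r delta F A B.

Lemma contracting_fix0 j : F j 0 = 0.
Proof.
have := ctr_bound ctr j; move=> /(_ 0); rewrite enorm0 => /(_ delta0) /andP[_].
by rewrite mulr0 => h; apply/enorm_eq0/eqP; rewrite eq_le h enorm_ge0.
Qed.

Lemma contracting_linear j v : s * N v <= N (A j v) <= r * N v.
Proof.
exact: (derivative_bounds v delta0 (contracting_fix0 j) (ctr_der ctr j) (ctr_bound ctr j)).
Qed.

Lemma pullback_bound j v : N (pullback B j v) <= s^-1 ^+ j * N v.
Proof.
elim: j v => [|j IH] v /=; first by rewrite expr0 mul1r.
apply: le_trans (IH _) _; rewrite exprSr -mulrA ler_pM2l ?exprn_gt0 ?invr_gt0//.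
by rewrite ler_pdivlMl// -{2}(ctr_AB ctr j v); have /andP[] := contracting_linear j (B j v).
Qed.

Lemma iterates_bound j z : N z < delta -> N (iterates F j z) <= r ^+ j * N z /\ N (iterates F j z) < delta.
Proof.
have rlt1 := r1.
move=> zd; elim: j => [|j [IH1 IH2]] /=; first by rewrite expr0 mul1r.
have /andP[_ h] := ctr_bound ctr j IH2; have h0 := enorm_ge0 (iterates F j z).
split; last by nra.
by apply: le_trans h _; rewrite exprS -mulrA ler_pM2l.
Qed.

Lemma iterates_diff j z : N z < delta -> differentiable (iterates F j) z.
Proof.
move=> zd; elim: j => [|j IH].
  by rewrite (_ : iterates F 0 = id) //; exact: differentiable_idV.
rewrite (_ : iterates F j.+1 = F j \o iterates F j)//.
apply: differentiable_comp IH _.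
by apply: (ctr_diff ctr); have [] := iterates_bound j zd.
Qed.

Lemma rescaled_diff j z : N z < delta -> differentiable (rescaled F B j) z.
Proof.
move=> zd; rewrite (_ : rescaled F B j = pullback B j \o iterates F j)//.
by apply: differentiable_comp; [exact: iterates_diff|exact: pullback_diff].
Qed.

(** The constant of the second order estimate of all the maps [F j]. *)
Definition step_const := k%:R * (1152 * (r * delta) / delta ^+ 2).

Lemma step_const_ge0 : 0 <= step_const.
Proof.
by apply: mulr_ge0; [exact: ler0n|apply: taylor_bound_ge0; rewrite mulr_ge0// ltW].
Qed.

Lemma contracting_second_order j z : N z < delta / 4 ->
  N (F j z - A j z) <= step_const * N z ^+ 2.
Proof.
move=> zd; have vb : vdiff_bounded (F j) 0 delta (r * delta).
  move=> w; rewrite subr0 => wd; split; first by apply/vdiffP; exact: (ctr_diff ctr).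
  by have /andP[_ /le_trans->//] := ctr_bound ctr j wd; rewrite ler_pM2l// ltW.
have := holo_taylor delta0 vb (ctr_der ctr j) zd.
by rewrite add0r contracting_fix0 subr0 mulrA.
Qed.

Lemma step_over_s_ge0 : 0 <= step_const / s.
Proof. exact: divr_ge0 step_const_ge0 (ltW s0). Qed.

Definition disp_const := 2 * (step_const / s) / (1 - r ^+ 2 / s).

Lemma ratio_lt1 : r ^+ 2 / s < 1.
Proof. by rewrite ltr_pdivrMr// mul1r. Qed.

Lemma ratio_ge0 : 0 <= r ^+ 2 / s.
Proof. by rewrite divr_ge0 ?sqr_ge0// ltW. Qed.

Lemma disp_const_ge0 : 0 <= disp_const.
Proof.
have h := ratio_lt1; apply: divr_ge0; last by lra.
by apply: mulr_ge0; [exact: ler0n|exact: step_over_s_ge0].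
Qed.

(** With y = F(j)(z), the difference is A(j+1)^-1 (F_j y - A_j y): the inverse costs
s^-(j+1), while the second order estimate gains the square of |y| <= r^j |z|. *)
Lemma rescaled_step j z : N z < delta / 4 ->
  N (rescaled F B j.+1 z - rescaled F B j z) <= step_const / s * N z ^+ 2 * (r ^+ 2 / s) ^+ j.
Proof.
have dpos := delta0.
move=> zd; have zd' : N z < delta by lra.
have [ob1 ob2] := iterates_bound j zd'.
set y := iterates F j z in ob1 ob2.
have rj : r ^+ j <= 1 by apply: exprn_ile1; exact: ltW.
have yd : N y < delta / 4.
  by apply: le_lt_trans ob1 (le_lt_trans _ zd); rewrite ler_piMl.
have -> : rescaled F B j.+1 z - rescaled F B j z = pullback B j.+1 (F j y - A j y).
  by rewrite pullbackB /= (ctr_BA ctr).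
apply: le_trans (pullback_bound _ _) _.
apply: (@le_trans _ _ (s^-1 ^+ j.+1 * (step_const * (r ^+ j * N z) ^+ 2))).
  rewrite ler_pM2l ?exprn_gt0 ?invr_gt0//; apply: le_trans (contracting_second_order j yd) _.
  apply: (ler_wpM2l step_const_ge0); rewrite ler_pXn2r ?nnegrE ?mulr_ge0 ?exprn_ge0//; exact: ltW.
rewrite le_eqVlt; apply/orP; left; apply/eqP.
rewrite [s^-1 ^+ _]exprS [(r ^+ j * _) ^+ 2]exprMn exprAC [(r ^+ 2 / s) ^+ j]exprMn.
by move: step_const (s^-1 ^+ j) (r ^+ 2 ^+ j) (N z ^+ 2) (s^-1) => *; ring.
Qed.

Lemma rescaled_limit z : N z < delta / 4 -> exists l, vlim (fun j => rescaled F B j z) l.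
Proof.
move=> zd.
have [|||l ll _] := @vlim_geometric _ _ _ _ _ _ _ _ (fun j => rescaled_step j zd); last by exists l.
- exact: mulr_ge0 step_over_s_ge0 (sqr_ge0 _).
- exact: ratio_ge0.
- exact: ratio_lt1.
Qed.

(** Triangle inequality through the limit: the j-th rescaled iterate and the 0-th,
which is the identity, are both within the sum of the geometric series from it. *)
Lemma rescaled_displacement j z : N z < delta / 4 ->
  N (rescaled F B j z - z) <= disp_const * N z ^+ 2.
Proof.
move=> zd.
have [|||l _ H] := @vlim_geometric _ _ _ _ _ _ _ _ (fun j => rescaled_step j zd).
- exact: mulr_ge0 step_over_s_ge0 (sqr_ge0 _).
- exact: ratio_ge0.
- exact: ratio_lt1.
have h1 := H j; have h2 := H 0%N.
have q1 := ratio_lt1; have q0 := ratio_ge0.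
set K := step_const / s * N z ^+ 2 in h1 h2.
have K0 : 0 <= K by exact: mulr_ge0 step_over_s_ge0 (sqr_ge0 _).
have qj : (r ^+ 2 / s) ^+ j <= 1 by apply: exprn_ile1 => //; exact: ltW.
have i0 : 0 < 1 - r ^+ 2 / s by lra.
have h3 : K * (r ^+ 2 / s) ^+ j / (1 - r ^+ 2 / s) <= K / (1 - r ^+ 2 / s).
  by rewrite ler_pM2r ?invr_gt0// ler_piMr.
rewrite expr0 mulr1 in h2.
have -> : disp_const * N z ^+ 2 = K / (1 - r ^+ 2 / s) + K / (1 - r ^+ 2 / s).
  rewrite /K /disp_const; move: (step_const / s) ((1 - r ^+ 2 / s)^-1) => a b; ring.
apply: le_trans (enorm_tri _ l _) _; rewrite enormBC; apply: lerD => //.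
exact: le_trans h3.
Qed.

(** It depends on k, s, r and delta only, so that it serves all the tails of the
sequence. The first term keeps balls of radius 8 times this one, centred in
the ball, inside the domain of convergence; the second makes the Lipschitz
constant k * 24 * disp_const * 9^2 / 8 times the radius at most 1/2. *)
Definition conj_radius := Num.min (delta / 36) (1 / (2 * (243 * (k%:R * disp_const) + 1))).

Lemma conj_radius_gt0 : 0 < conj_radius.
Proof.
have h : 0 <= k%:R * disp_const by exact: mulr_ge0 (ler0n _ _) disp_const_ge0.
by rewrite lt_min; apply/andP; split; rewrite divr_gt0//; lra.
Qed.

Lemma conj_radius_delta : 9 * conj_radius <= delta / 4.
Proof.
have : conj_radius <= delta / 36 by rewrite ge_min lexx.
lra.
Qed.

Lemma conj_radius_const : 243 * (k%:R * disp_const) * conj_radius <= 2^-1.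
Proof.
have h : 0 <= k%:R * disp_const by exact: mulr_ge0 (ler0n _ _) disp_const_ge0.
have : conj_radius <= 1 / (2 * (243 * (k%:R * disp_const) + 1)) by rewrite ge_min lexx orbT.
rewrite ler_pdivlMr; last by lra.
have := conj_radius_gt0; lra.
Qed.

(** With rho the radius, the displacement is at most [disp_const] (9 rho)^2 on the
ball of radius 8 rho around y, so its Lipschitz constant is of order rho: the
bound gains one power of rho because the displacement is quadratic. *)
Lemma rescaled_perturbation j x y : N x < conj_radius -> N y < conj_radius ->
  N (rescaled F B j x - rescaled F B j y - (x - y)) <= 2^-1 * N (x - y).
Proof.
have dpos := delta0.
move=> xr yr; have e0 := conj_radius_gt0; have ed := conj_radius_delta.
pose e z := rescaled F B j z - z.
have r8 : 0 < 8 * conj_radius by lra.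
have vb : vdiff_bounded e y (8 * conj_radius) (disp_const * (9 * conj_radius) ^+ 2).
  move=> z zy; have zr : N z <= 9 * conj_radius.
    by have := enormD (z - y) y; rewrite subrK; lra.
  have zd : N z < delta / 4.
    by have := enormD (z - y) y; rewrite subrK; lra.
  split.
    by apply: vdiff_sub_id; apply/vdiffP; apply: rescaled_diff; lra.
  apply: le_trans (rescaled_displacement j zd) _.
  by apply: (ler_wpM2l disp_const_ge0); rewrite ler_pXn2r ?nnegrE ?enorm_ge0//; lra.
have hr : N (x - y) < 8 * conj_radius / 2.
  by have := enormB x y; lra.
have := holo_lipschitz r8 vb hr; rewrite subrKC.
rewrite (_ : _ - _ - (x - y) = e x - e y); last first.
  rewrite /e; move: (rescaled F B j x) (rescaled F B j y) => a b.
  by apply/rowP => i; rewrite !mxE; ring.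
move/le_trans; apply.
rewrite (_ : k%:R * _ = 243 * (k%:R * disp_const) * conj_radius * N (x - y)); last first.
  by field; exact: lt0r_neq0.
by rewrite ler_wpM2r// conj_radius_const.
Qed.

Lemma local_conjugacy : exists Psi : V -> V,
  [/\ forall z, N z < conj_radius -> vlim (fun j => rescaled F B j z) (Psi z),
      forall x y, N x < conj_radius -> N y < conj_radius ->
        N (Psi x - Psi y - (x - y)) <= 2^-1 * N (x - y) &
      forall x, N x < conj_radius -> vdiff Psi x].
Proof.
have dpos := delta0.
have e0 := conj_radius_gt0; have ed := conj_radius_delta.
have : forall z, exists l, N z < delta / 4 -> vlim (fun j => rescaled F B j z) l.
  move=> z; have [zd|zd] := ltP (N z) (delta / 4); last by exists 0.
  by have [l ll] := rescaled_limit zd; exists l.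
move=> /choice[Psi HPsi]; exists Psi; split.
- by move=> z zr; apply: HPsi; lra.
- move=> x y xr yr.
  apply: (vlim_le (u := fun j => rescaled F B j x - rescaled F B j y - (x - y))).
    by apply: vlimB (vlim_cst _); apply: vlimB; apply: HPsi; lra.
  by move=> j; exact: rescaled_perturbation.
- move=> x xr.
  apply: (@holo_limit R k (rescaled F B) Psi x conj_radius (delta / 4 + disp_const * (delta / 4) ^+ 2)) => //.
    move=> j z zx; have zr : N z < delta / 4.
      by have := enormD (z - x) x; rewrite subrK; lra.
    split; first by apply/vdiffP; apply: rescaled_diff; lra.
    rewrite -(subrK z (rescaled F B j z)) addrC; apply: le_trans (enormD _ _) _.
    apply: lerD; first exact: ltW.
    apply: le_trans (rescaled_displacement j zr) _.
    by apply: (ler_wpM2l disp_const_ge0); rewrite ler_pXn2r ?nnegrE ?enorm_ge0//; lra.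
  move=> z zx; apply: HPsi.
  by have := enormD (z - x) x; rewrite subrK; lra.
Qed.

End Estimates.

End LocalConjugacy.

(** * From the neighbourhood of the fixed point to the basin *)

Section BasinAtOrigin.
Variables (R : realType) (k : nat).
Notation C := (Cplx R).
Notation V := 'rV[Cplx R]_k.
Notation N := (@enorm R k).
Implicit Types (u v w x y z h : V) (c : C) (s r delta eta : R) (f : V -> V).
Implicit Types (F G : nat -> V -> V) (A B : nat -> {linear V -> V}).

Lemma vdiff_local f g a d : 0 < d -> (forall z, N (z - a) < d -> f z = g z) ->
  vdiff f a -> vdiff g a.
Proof.
move=> d0 fg [L H]; exists L => e e0; have [d1 d10 Hd] := H e e0.
exists (Num.min d1 d); first by rewrite lt_min d10.
move=> z; rewrite lt_min => /andP[/Hd + zd]; rewrite fg// fg//.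
by rewrite subrr enorm0.
Qed.

Lemma vdiff_translate f a b z : vdiff f (z + a) -> vdiff (fun w => f (w + a) + b) z.
Proof.
have E w : w + a - (z + a) = w - z by rewrite opprD addrACA subrr addr0.
move=> [L HL]; exists L => e /HL[d d0 Hd]; exists d => // w wz.
have := Hd (w + a); rewrite E => /(_ wz).
by rewrite (_ : f (w + a) + b - (f (z + a) + b) = f (w + a) - f (z + a))// opprD addrACA subrr addr0.
Qed.

Lemma vder_comp f g a (L M : {linear V -> V}) : vder f a L -> vder g (f a) M ->
  vder (g \o f) a (M \o L).
Proof.
move=> HL HM e e0.
have [K K0 HK] := linear_enorm_bounded M; have [K' K'0 HK'] := linear_enorm_bounded L.
have [d1 d10 H1] := HL 1 ltr01.
have e1 : 0 < e / 2 / (K' + 1) by rewrite divr_gt0//; lra.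
have [d2 d20 H2] := HM _ e1.
have e2 : 0 < e / 2 / K by rewrite divr_gt0//; lra.
have [d3 d30 H3] := HL _ e2.
have d4 : 0 < d2 / (K' + 1) by rewrite divr_gt0//; lra.
exists (Num.min d1 (Num.min d3 (d2 / (K' + 1)))); first by rewrite !lt_min d10 d30.
move=> z; rewrite !lt_min => /and3P[/H1 h1 /H3 h3]; rewrite ltr_pdivlMr; last by lra.
move=> h4; have z0 := enorm_ge0 (z - a).
have h5 : N (f z - f a) <= (K' + 1) * N (z - a).
  have := enormD (f z - f a - L (z - a)) (L (z - a)); rewrite subrK.
  have := HK' (z - a); lra.
have h6 : N (g (f z) - g (f a) - M (f z - f a)) <= e / 2 / (K' + 1) * N (f z - f a).
  by apply: H2; lra.
have h7 : e / 2 / (K' + 1) * N (f z - f a) <= e / 2 * N (z - a).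
  apply: le_trans (ler_wpM2l (ltW e1) h5) _.
  rewrite le_eqVlt; apply/orP; left; apply/eqP; field; rewrite gt_eqF//; lra.
have h8 : N (M (f z - f a - L (z - a))) <= e / 2 * N (z - a).
  apply: le_trans (HK _) _; apply: le_trans (ler_wpM2l (ltW K0) h3) _.
  rewrite le_eqVlt; apply/orP; left; apply/eqP; field; exact: lt0r_neq0.
rewrite (_ : _ - _ - _ = (g (f z) - g (f a) - M (f z - f a)) + M (f z - f a - L (z - a))).
  by apply: le_trans (enormD _ _) _; lra.
by rewrite [M (f z - f a - _)]linearB /= addrA subrK.
Qed.

Lemma vdiff_comp f g z : vdiff f z -> vdiff g (f z) -> vdiff (g \o f) z.
Proof. by move=> [L HL] [M HM]; exists (M \o L); exact: vder_comp. Qed.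

Lemma vdiff_continuous f a e : vdiff f a -> 0 < e ->
  exists2 d, 0 < d & forall z, N (z - a) < d -> N (f z - f a) < e.
Proof.
move=> /vdiffP/differentiable_continuous cf e0.
have : nbhs (f a) [set y | N (y - f a) < e] by apply/nbhs_enorm; exists e.
by move=> /cf/nbhs_enorm.
Qed.

(** Uniqueness of the derivative of the identity, by homogeneity. *)
Lemma vder_id_fix a (L : {linear V -> V}) : vder id a L -> forall v, L v = v.
Proof.
move=> H v; have [->|v0] := eqVneq v 0; first by rewrite linear0.
have n0 := enorm_gt0 v0.
apply/eqP; rewrite -subr_eq0 -oppr_eq0 opprB; apply/eqP/le_eps_enorm0 => e e0.
have [d d0 Hd] := H _ (divr_gt0 e0 n0).
have t0 : 0 < d / 2 / N v by rewrite !divr_gt0.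
have Nt : N ((d / 2 / N v)%:C *: v) = d / 2.
  by rewrite enormZ cn_real ger0_norm ?ltW// divfK// gt_eqF.
have := Hd (a + (d / 2 / N v)%:C *: v); rewrite (addrC a) addrK Nt => /(_ _) h.
have {h} : N ((d / 2 / N v)%:C *: v - L ((d / 2 / N v)%:C *: v)) <= e / N v * (d / 2).
  by apply: h; lra.
rewrite [L _]linearZ -scalerBr enormZ cn_real (ger0_norm (ltW t0)) => h.
rewrite -(ler_pM2l t0); apply: le_trans h _.
rewrite le_eqVlt; apply/orP; left; apply/eqP; field; exact: lt0r_neq0.
Qed.

Lemma derivative_inverse f g (A B : {linear V -> V}) : f 0 = 0 -> vder f 0 A -> vder g 0 B ->
  (forall z, g (f z) = z) -> forall v, B (A v) = v.
Proof.
move=> f0 HA HB gf; rewrite -f0 in HB; have := vder_comp HA HB.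
rewrite (_ : g \o f = id); last exact/funext.
exact: (@vder_id_fix 0 (B \o A)).
Qed.

Fixpoint backorbit G j z := if j is j'.+1 then backorbit G j' (G j' z) else z.

Lemma vlim_shift (u : nat -> V) n l : vlim (fun j => u (n + j)%N) l -> vlim u l.
Proof.
move=> H e e0; have [m Hm] := H e e0; exists (n + m)%N => p np.
have pn : (n <= p)%N by exact: leq_trans (leq_addr m n) np.
by have := Hm (p - n)%N; rewrite subnKC// leq_subRL// => /(_ np).
Qed.

(** On the set where F(n)(z) is in the common ball, Phi is A(n)^-1 o Psi_n o F(n),
and near w its inverse is F(n)^-1 o psi_n o A(n) for any n with A(n) w in the half
ball, where psi_n inverts Psi_n. Two points of the basin have a common entrance
time, so the injectivity of Phi follows from that of Psi_n. *)
Theorem basin_at_origin s r delta F G : 0 < s -> s < r -> r < 1 -> r ^+ 2 < s -> 0 < delta ->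
  (forall j z, vdiff (F j) z) -> (forall j z, vdiff (G j) z) ->
  (forall j z, G j (F j z) = z) -> (forall j z, F j (G j z) = z) ->
  (forall j, F j 0 = 0) ->
  (forall j z, N z < delta -> s * N z <= N (F j z) <= r * N z) ->
  exists Phi Gam : V -> V, let Om z := vlim (fun j => iterates F j z) 0 in
  [/\ forall z, Om z -> vdiff Phi z /\ exists2 d, 0 < d & forall y, N (y - z) < d -> Om y,
      forall z, Om z -> Gam (Phi z) = z &
      forall w, [/\ Om (Gam w), Phi (Gam w) = w & vdiff Gam w]].
Proof.
move=> s0 sr r1 rs delta0 dF dG GF FG F0 Fb.
have r0 : 0 < r by lra.
have G0 j : G j 0 = 0 by rewrite -{1}(F0 j) GF.
have [A HA] := choice (fun j => dF j 0); have [B HB] := choice (fun j => dG j 0).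
have ctr : contracting s r delta F A B.
  split=> //.
  - by move=> j z _; apply/vdiffP.
  - move=> j; exact: (derivative_inverse (G0 j) (HB j) (HA j) (FG j)).
  - move=> j; exact: (derivative_inverse (F0 j) (HA j) (HB j) (GF j)).
pose eta := conj_radius k s r delta.
have eta0 : 0 < eta by exact: conj_radius_gt0.
have etad : eta < delta by have := conj_radius_delta k s r delta; rewrite -/eta; lra.
have [Psi HPsi] := choice (fun n => local_conjugacy s0 r0 r1 rs delta0 (contracting_shift n ctr)).
have Psi0 n : Psi n 0 = 0.
  have [H _ _] := HPsi n; apply: (vlim_uniq (H 0 _)); first by rewrite enorm0.
  move=> e e0; exists 0%N => m _; rewrite subr0 (_ : rescaled _ _ _ _ = 0) ?enorm0 ?ltW//.
  rewrite /rescaled (_ : iterates _ m 0 = 0); first by rewrite pullback0.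
  by elim: m => //= m ->.
pose Om z := vlim (fun j => iterates F j z) 0.
have Om_enter z : Om z -> forall e, 0 < e -> exists n, forall m, (n <= m)%N -> N (iterates F m z) < e.
  move=> Hz e e0; have e2 : 0 < e / 2 by lra.
  have [n Hn] := Hz _ e2; exists n => m /Hn; rewrite subr0; lra.
have Om_of_enter n z : N (iterates F n z) < delta -> Om z.
  move=> zd; apply: (@vlim_shift _ n) => e e0.
  have : r ^+ j @[j --> \oo] --> 0 by apply: cvg_expr; rewrite ger0_norm// ltW.
  have ed : 0 < e / delta by exact: divr_gt0.
  move=> /cvgrPdist_le/(_ _ ed)[m _ Hm]; exists m => q mq.
  have := Hm q mq; rewrite sub0r normrN (ger0_norm (exprn_ge0 _ (ltW r0))) ler_pdivlMr// => h.
  rewrite subr0 iterates_shift; apply: le_trans h.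
  have [ob _] := iterates_bound r0 r1 (contracting_shift n ctr) q zd.
  by apply: le_trans ob _; rewrite ler_wpM2l ?exprn_ge0// ltW.
(* The (n+j)-th rescaled iterate at z is A(n)^-1 applied to the j-th one of the
   tail at F(n)(z). *)
have lim_formula n z : N (iterates F n z) < eta ->
    vlim (fun j => rescaled F B j z) (pullback B n (Psi n (iterates F n z))).
  move=> zn; apply: (@vlim_shift _ n) => e e0; have [H _ _] := HPsi n.
  have e1 : 0 < e * s ^+ n by rewrite mulr_gt0// exprn_gt0.
  have [m Hm] := H _ zn _ e1; exists m => q mq.
  rewrite {1}/rescaled pullback_shift iterates_shift -pullbackB.
  apply: le_trans (pullback_bound s0 delta0 ctr _ _) _.
  by rewrite exprVn ler_pdivrMl ?exprn_gt0// mulrC; exact: Hm.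
have : forall z, exists l, Om z -> vlim (fun j => rescaled F B j z) l.
  move=> z; case: (pselect (Om z)) => [Hz|nz]; last by exists 0.
  have [n Hn] := Om_enter z Hz eta eta0; exists (pullback B n (Psi n (iterates F n z))) => _.
  by apply: lim_formula; exact: Hn.
move=> /choice[Phi HPhi].
have PhiE n z : N (iterates F n z) < eta -> Phi z = pullback B n (Psi n (iterates F n z)).
  move=> zn; apply: (vlim_uniq _ (lim_formula n z zn)); apply: HPhi.
  by apply: (Om_of_enter n); lra.
have dorb n z : vdiff (iterates F n) z.
  elim: n z => [|n IH] z; first by apply/vdiffP; exact: differentiable_idV.
  exact: (vdiff_comp (IH z) (dF n _)).
have near n z : N (iterates F n z) < eta ->
    exists2 d, 0 < d & forall y, N (y - z) < d -> N (iterates F n y) < eta.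
  move=> zn; have e0 : 0 < eta - N (iterates F n z) by lra.
  have [d d0 Hd] := vdiff_continuous (dorb n z) e0; exists d => // y /Hd.
  by have := enormD (iterates F n y - iterates F n z) (iterates F n z); rewrite subrK; lra.
have pb_diff n z : vdiff (pullback B n) z by apply/vdiffP; exact: pullback_diff.
pose push n := iterates (fun j => A j : V -> V) n.
have pushK n v : pullback B n (push n v) = v.
  by elim: n v => [//|n IH] v; rewrite -[LHS]/(pullback B n (B n (A n (push n v)))) (ctr_BA ctr) IH.
have pullK n v : push n (pullback B n v) = v.
  by elim: n v => [//|n IH] v; rewrite -[LHS]/(A n (push n (pullback B n (B n v)))) IH (ctr_AB ctr).
have push_bound n v : N (push n v) <= r ^+ n * N v.
  elim: n => [|n IH]; first by rewrite expr0 mul1r.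
  rewrite -[push n.+1 v]/(A n (push n v)); have /andP[_ h] := contracting_linear delta0 ctr n (push n v).
  by apply: le_trans h _; rewrite exprS -mulrA ler_pM2l.
have push_diff n v : vdiff (push n) v.
  elim: n v => [|n IH] v; first by apply/vdiffP; exact: differentiable_idV.
  by apply: (vdiff_comp (IH v)); exists (A n); exact: vder_linear.
have push_small w : exists n, N (push n w) < eta / 2.
  have w1 : 0 < N w + 1 by have := enorm_ge0 w; lra.
  have e1 : 0 < eta / 4 / (N w + 1) by rewrite !divr_gt0.
  have : r ^+ j @[j --> \oo] --> 0 by apply: cvg_expr; rewrite ger0_norm// ltW.
  move=> /cvgrPdist_le/(_ _ e1)[n _ Hn]; exists n.
  have := Hn n (leqnn n); rewrite sub0r normrN (ger0_norm (exprn_ge0 _ (ltW r0))) ler_pdivlMr// => h.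
  have rn : 0 <= r ^+ n by rewrite exprn_ge0// ltW.
  by apply: le_lt_trans (push_bound n w) _; lra.
have orbK n z : iterates F n (backorbit G n z) = z.
  by elim: n z => [//|n IH] z /=; rewrite IH FG.
have backK n z : backorbit G n (iterates F n z) = z.
  by elim: n z => [//|n IH] z /=; rewrite GF IH.
have dback n z : vdiff (backorbit G n) z.
  elim: n z => [|n IH] z; first by apply/vdiffP; exact: differentiable_idV.
  exact: (vdiff_comp (dG n z) (IH _)).
have Psi_inj n x y : N x < eta -> N y < eta -> Psi n x = Psi n y -> x = y.
  move=> xr yr E; have [_ H _] := HPsi n; have := H x y xr yr.
  rewrite E subrr sub0r enormN => h; apply/eqP; rewrite -subr_eq0.
  by apply/eqP/enorm_eq0/eqP; rewrite eq_le enorm_ge0 andbT; lra.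
have Phi_inj z z' : Om z -> Om z' -> Phi z = Phi z' -> z = z'.
  move=> Hz Hz' E; have [n Hn] := Om_enter z Hz eta eta0.
  have [m Hm] := Om_enter z' Hz' eta eta0.
  set q := maxn n m; have zq := Hn q (leq_maxl _ _); have zq' := Hm q (leq_maxr _ _).
  move: E; rewrite (PhiE q z zq) (PhiE q z' zq') => /(congr1 (push q)).
  rewrite !pullK => /(Psi_inj q _ _ zq zq') /(congr1 (backorbit G q)).
  by rewrite !backK.
have inv n : exists psi : V -> V, forall w, N w < eta / 2 -> N (psi w) < eta /\ Psi n (psi w) = w.
  have [_ H _] := HPsi n.
  have : forall w, exists z, N w < eta / 2 -> N z < eta /\ Psi n z = w.
    move=> w; have [wr|wr] := ltP (N w) (eta / 2); last by exists 0.
    by have [z zr E] := banach_perturbation (Psi0 n) H wr; exists z.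
  by move=> /choice[psi]; exists psi.
have [psi Hpsi] := choice inv.
pose gam n w := backorbit G n (psi n (push n w)).
have gamP n w : N (push n w) < eta / 2 -> Om (gam n w) /\ Phi (gam n w) = w.
  move=> wr; have [pr E] := Hpsi n _ wr; split.
    by apply: (Om_of_enter n); rewrite orbK; lra.
  by rewrite (PhiE n) orbK// E pushK.
have : forall w, exists z, Om z /\ Phi z = w.
  by move=> w; have [n wn] := push_small w; exists (gam n w); exact: gamP.
move=> /choice[Gam HGam]; exists Phi, Gam; rewrite -/Om; split.
- move=> z Hz; have [n Hn] := Om_enter z Hz eta eta0.
  have zn := Hn n (leqnn n); have [d d0 Hd] := near n z zn; split; last first.
    by exists d => // y /Hd yn; apply: (Om_of_enter n); lra.
  apply: (@vdiff_local (pullback B n \o (Psi n \o iterates F n)) _ _ d d0).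
    by move=> y /Hd yn; rewrite (PhiE n).
  apply: vdiff_comp => //; apply: vdiff_comp => //.
  by have [_ _ H] := HPsi n; exact: H.
- by move=> z Hz; have [h1 h2] := HGam (Phi z); exact: Phi_inj.
- move=> w; have [h1 h2] := HGam w; split=> //.
  have [n wn] := push_small w.
  have e0 : 0 < eta / 2 - N (push n w) by lra.
  have [d d0 Hd] := vdiff_continuous (push_diff n w) e0.
  apply: (@vdiff_local (backorbit G n \o (psi n \o push n)) _ _ d d0).
    move=> v /Hd vd; have vn : N (push n v) < eta / 2.
      by have := enormD (push n v - push n w) (push n w); rewrite subrK; lra.
    have [g1 g2] := gamP n v vn; have [g3 g4] := HGam v.
    by apply: Phi_inj => //; rewrite g4.
  apply: vdiff_comp => //; apply: vdiff_comp => //.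
  have [_ H1 H2] := HPsi n.
  exact: (perturbation_inverse_diff H1 H2 (Hpsi n)).
Qed.

End BasinAtOrigin.

Theorem theorem4 (R : realType) (k : nat) (hk : (2 <= k)%N)
    (p : 'rV[Cplx R]_k) (s r : R) (hs : 0 < s) (hsr : s < r) (hr : r < 1)
    (hrs : r ^+ 2 < s) (delta : R) (hdelta : 0 < delta)
    (F : nat -> 'rV[Cplx R]_k -> 'rV[Cplx R]_k)
    (hF : forall j : nat, (1 <= j)%N -> Aut_at p (F j))
    (hbound : forall (j : nat) (z : 'rV[Cplx R]_k), (1 <= j)%N ->
       eball p delta z ->
       s * enorm (z - p) <= enorm (F j z - p) /\
       enorm (F j z - p) <= r * enorm (z - p)) :
  exists Phi : 'rV[Cplx R]_k -> 'rV[Cplx R]_k,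
    biholomorphic (basin p F) setT Phi.
Proof.
have vb : forall z : 'rV[Cplx R]_k, enorm z < delta -> eball p delta (z + p).
  by move=> z zd; rewrite /eball/= addrK.
(* Translation of p to 0, with the indices starting at 0. *)
pose F' j z := F j.+1 (z + p) - p.
have autF j : Aut_at p (F j.+1) by exact: hF.
have : forall j, exists g : 'rV[Cplx R]_k -> 'rV[Cplx R]_k,
    [/\ forall z, vdiff g z, forall z, g (F j.+1 z) = z & forall z, F j.+1 (g z) = z].
  move=> j; have [[_ [_ _ surj] [g [[_ dg] gF]]] _] := autF j; exists g; split.
  - by move=> z; apply/vdiffP; exact: dg.
  - by move=> z; exact: gF.
  - by move=> w; have [z _ <-] := surj w I; rewrite gF.
move=> /choice[G HG].
pose G' j z := G j (z + p) - p.
have dF' j z : vdiff (F' j) z.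
  apply: vdiff_translate; apply/vdiffP.
  by have [[[_ dF] _ _] _] := autF j; exact: dF.
have dG' j z : vdiff (G' j) z by apply: vdiff_translate; have [dg _ _] := HG j; exact: dg.
have GF' j z : G' j (F' j z) = z by have [_ h _] := HG j; rewrite /G' /F' subrK h addrK.
have FG' j z : F' j (G' j z) = z by have [_ _ h] := HG j; rewrite /G' /F' subrK h addrK.
have F0' j : F' j 0 = 0 by have [_ fp] := autF j; rewrite /F' add0r fp subrr.
have Fb' j z : enorm z < delta -> s * enorm z <= enorm (F' j z) <= r * enorm z.
  move=> /vb zd; have [] := hbound j.+1 _ isT zd; rewrite addrK /F' => -> ->.
  by [].
have [Phi [Gam [H1 H2 H3]]] := basin_at_origin hs hsr hr hrs hdelta dF' dG' GF' FG' F0' Fb'.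
have iterE j z : comp_upto F j z = iterates F' j (z - p) + p.
  elim: j => [|j IH]; first by rewrite /= subrK.
  by rewrite /= IH /F' subrK.
have basinE z : basin p F z <-> vlim (fun j => iterates F' j (z - p)) 0.
  rewrite /basin/= vlim_cvg; split=> H e /H[n Hn]; exists n => m /Hn; by rewrite iterE addrK subr0.
exists (fun z => Phi (z - p)); split.
- split.
    rewrite openE => z /basinE/H1[_ [d d0 Hd]]; apply/nbhs_enorm; exists d => // y yz.
    by apply/basinE/Hd; rewrite opprB addrA subrK.
  move=> z /basinE/H1[dPhi _]; apply/vdiffP.
  rewrite (_ : (fun y => Phi (y - p)) = (fun y => Phi (y - p) + 0)); last first.
    by apply/funext => y; rewrite addr0.
  exact: vdiff_translate.
- split.
  + by [].
  + move=> z z'; rewrite !inE => /basinE hz /basinE hz' /(congr1 Gam).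
    by rewrite !H2// => /(congr1 (+%R^~ p)); rewrite !subrK.
  + move=> w _; have [h1 h2 _] := H3 w; exists (Gam w + p); last by rewrite addrK.
    by apply/basinE; rewrite addrK.
- exists (fun w => Gam w + p); split; last first.
    by move=> z /basinE hz; rewrite H2// subrK.
  split; first exact: openT.
  move=> w _; apply/vdiffP.
  have [_ _ dGam] := H3 w; rewrite -(addr0 w) in dGam.
  rewrite (_ : (fun y => Gam y + p) = (fun y => Gam (y + 0) + p)); last first.
    by apply/funext => y; rewrite addr0.
  exact: vdiff_translate.
Qed.
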